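(* Suppose $Q^n$ is a small cover over an $n$-dimensional simple polytope $P^n$ and $M^n$ is a principal $(\mathbb{Z}_2)^m$-bundle over $Q^n$. If $M^n$ is connected, then $M^n$ is equivalent to a partial quotient $\mathcal{Z}_{P^n}/H$ as principal $(\mathbb{Z}_2)^m$-bundles over $Q^n$. That is, if $d$ is the number of facets of $P^n$, there are subgroups $H\subset\widetilde{H}\subset(\mathbb{Z}_2)^d$ such that $\widetilde H$ (hence $H$) acts freely on $\mathcal{Z}_{P^n}$ through the canonical action, $\widetilde{H}/H\cong(\mathbb{Z}_2)^m$, $\mathcal{Z}_{P^n}/\widetilde{H}$ is homeomorphic to $Q^n$, and $M^n$ is equivalent, as a principal $(\mathbb{Z}_2)^m$-bundle over $Q^n$, to $\mathcal{Z}_{P^n}/H$ with the canonical $\widetilde{H}/H$-action.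
   Context: $\mathbb{Z}_2=\mathbb{Z}/2\mathbb{Z}$; all manifolds are smooth. A simple $n$-polytope is a convex $n$-polytope in which each vertex lies on exactly $n$ facets. A small cover over a simple polytope $P^n$ is a closed $n$-manifold with a locally standard $(\mathbb{Z}_2)^n$-action (locally modelled on the standard action of $(\mathbb{Z}_2)^n$ on $\mathbb{R}^n$ by coordinate reflections) whose orbit space is $P^n$. Real moment-angle manifold: if $P^n$ has facets $F_1,\dots,F_d$ and $e_1,\dots,e_d$ is a basis of $(\mathbb{Z}_2)^d$, then $\mathcal{Z}_{P^n}$ is the quotient of $P^n\times(\mathbb{Z}_2)^d$ by the equivalence relation generated by $(p,g)\sim(p,g+e_i)$ for $p\in F_i$, $1\le i\le d$. The canonical action of $(\mathbb{Z}_2)^d$ on $\mathcal{Z}_{P^n}$ is $g_0\cdot[(p,g)]=[(p,g_0+g)]$; its orbit space is $P^n$. If a subgroup $H\subset(\mathbb{Z}_2)^d$ acts freely on $\mathcal{Z}_{P^n}$ through the canonical action, $\mathcal{Z}_{P^n}/H$ is called a partial quotient of $\mathcal{Z}_{P^n}$. If $\widetilde H\supset H$ is a subgroup of $(\mathbb{Z}_2)^d$ which also acts freely through the canonical action, the induced free action of $\widetilde H/H$ on $\mathcal{Z}_{P^n}/H$, with orbit space $\mathcal{Z}_{P^n}/\widetilde H$, is also called canonical. When $\widetilde H/H\cong(\mathbb{Z}_2)^m$ and $\mathcal{Z}_{P^n}/\widetilde H$ is identified with $Q^n$ by a homeomorphism, this makes $\mathcal{Z}_{P^n}/H$ a principal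 $(\mathbb{Z}_2)^m$-bundle over $Q^n$. Two principal $(\mathbb{Z}_2)^m$-bundles $M_1,M_2$ over $Q^n$ are equivalent if there are a homeomorphism $f:M_1\to M_2$ and a group automorphism $\sigma$ of $(\mathbb{Z}_2)^m$ such that $f(g\cdot x)=\sigma(g)\cdot f(x)$ for all $g\in(\mathbb{Z}_2)^m$, $x\in M_1$, and $f$ induces the identity map on the orbit space $Q^n$. *)

(* Defs.v *)
From HB Require Import structures.
From Stdlib Require Import Relation_Operators.
From mathcomp Require Import all_boot all_order all_algebra all_fingroup.
From mathcomp Require Import generic_quotient.
From mathcomp Require Import all_classical all_reals all_analysis.

Set Implicit Arguments.
Unset Strict Implicit.
Unset Printing Implicit Defensive.

Import Order.TTheory GRing.Theory Num.Theory.
Import numFieldNormedType.Exports.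

Local Open Scope classical_set_scope.
Local Open Scope ring_scope.
Local Open Scope quotient_scope.
Local Open Scope card_scope.

(* (Z/2)^n, in additive notation; its structure of finGroupType is the
   additive one, i.e. (x * y)%g is x + y and 1%g is 0. *)
Notation Z2 n := 'rV['Z_2]_n.

Section Quot.
Variables (T : topologicalType) (E : T -> T -> Prop).

Definition gen_rel : rel T := fun x y => `[< clos_refl_sym_trans T E x y >].

Lemma gen_rel_refl : reflexive gen_rel.
Proof. by move=> x; apply/asboolP; exact: rst_refl. Qed.

Lemma gen_rel_sym : symmetric gen_rel.
Proof. by move=> x y; apply/asboolP/asboolP => ?; exact: rst_sym. Qed.

Lemma gen_rel_trans : transitive gen_rel.
Proof.
move=> y x z /asboolP xy /asboolP yz; apply/asboolP.
exact: rst_trans xy yz.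
Qed.

Canonical gen_equiv_rel := EquivRel gen_rel gen_rel_refl gen_rel_sym gen_rel_trans.

Definition quot : Type := {eq_quot gen_equiv_rel}.
HB.instance Definition _ := Topological.copy quot (quotient_topology quot).
HB.instance Definition _ := Quotient.on quot.

Lemma quotP (x y : T) :
  \pi_quot x = \pi_quot y <-> clos_refl_sym_trans T E x y.
Proof.
rewrite /quot; split; first by move/eqmodP => /asboolP.
by move=> xy; apply/eqmodP/asboolP.
Qed.

Lemma quot_repr (x : T) :
  clos_refl_sym_trans T E x (repr (\pi_quot x)).
Proof. by apply/quotP; rewrite reprK. Qed.

Lemma quot_ind2 (U : Type) (f : T -> U) :
  (forall x y, E x y -> f x = f y) ->
  forall x y, clos_refl_sym_trans T E x y -> f x = f y.
Proof.
move=> fE x y; by elim=> {x y} [x y /fE|x|x y _ ->|x y z _ -> _ ->].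
Qed.

End Quot.

Definition homeomorphism (X Y : topologicalType) (f : X -> Y) : Prop :=
  exists g : Y -> X, [/\ cancel f g, cancel g f, continuous f & continuous g].

(* f and g restrict to mutually inverse homeomorphisms between the open sets
   U and V; the values of f outside U and of g outside V are irrelevant. *)
Definition open_homeo (X Y : topologicalType) (U : set X) (V : set Y)
    (f : X -> Y) (g : Y -> X) : Prop :=
  [/\ open U /\ open V,
      forall x, U x -> V (f x) /\ g (f x) = x,
      forall y, V y -> U (g y) /\ f (g y) = y,
      {within U, continuous f} &
      {within V, continuous g}].

(* The library states these facts for actions on finite types only. *)
Section ActionTheory.
Variables (gT : finGroupType) (X : Type) (to : {action gT &-> X}).

Lemma actTM x : act_morph to x.
Proof.
have [_ toM] : is_action [set: gT]%SET to by case: to.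
by move=> a b; apply: toM; rewrite inE.
Qed.

Lemma actT1 x : to x 1%g = x.
Proof.
have [to_inj _] : is_action [set: gT]%SET to by case: to.
by apply: (to_inj 1%g); rewrite -actTM mulg1.
Qed.

Lemma actTK x g : to (to x g) g^-1%g = x.
Proof. by rewrite -actTM mulgV actT1. Qed.

End ActionTheory.

Section OrbitSpace.
Variables (gT : finGroupType) (X : topologicalType) (to : {action gT &-> X}).

Definition continuous_action : Prop := forall g, continuous (to^~ g).

Definition free_action (H : {group gT}) : Prop :=
  forall x h, h \in H -> to x h = x -> h = 1%g.

Definition orbit_rel (H : {group gT}) (x y : X) : Prop :=
  exists2 h, h \in H & y = to x h.

Definition orbit_space (H : {group gT}) : Type := quot (orbit_rel H).
HB.instance Definition _ H := Topological.on (orbit_space H).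
HB.instance Definition _ H := Quotient.on (orbit_space H).

Definition orbit_proj (H K : {group gT}) (z : orbit_space H) : orbit_space K :=
  \pi_(orbit_space K) (repr z).

(* The action induced on X / H by the cosets of H. Elements of [coset_of H]
   are cosets of H in its normaliser, which is the whole group when gT is
   abelian. *)
Definition orbit_space_act (H : {group gT}) (z : orbit_space H)
    (c : coset_of H) : orbit_space H :=
  \pi_(orbit_space H) (to (repr z) (fingroup.repr c)).

Lemma orbit_spaceP (H : {group gT}) (x y : X) :
  \pi_(orbit_space H) x = \pi_(orbit_space H) y <-> orbit_rel H x y.
Proof.
rewrite quotP; split; last exact: rst_step.
elim=> {x y} [x y //|x|x y _ [h hH ->]|x y z _ [h hH ->] _ [k kH ->]].
- by exists 1%g; rewrite ?group1 ?actT1.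
- by exists h^-1%g; rewrite ?groupV // actTK.
- by exists (h * k)%g; rewrite ?groupM // actTM.
Qed.

Lemma orbit_projE (H K : {group gT}) (x : X) : H \subset K ->
  orbit_proj K (\pi_(orbit_space H) x) = \pi_(orbit_space K) x.
Proof.
move=> /fintype.subsetP HK; apply/orbit_spaceP.
have /orbit_spaceP [h hH xE] := reprK (\pi_(orbit_space H) x).
by exists h => //; apply: HK.
Qed.

Lemma orbit_space_actE (H : {group gT}) (x : X) (g : gT) : g \in 'N(H)%g ->
  orbit_space_act (\pi_(orbit_space H) x) (coset H g) =
  \pi_(orbit_space H) (to x g).
Proof.
move=> gN; apply/orbit_spaceP.
have /orbit_spaceP [h hH xE] := reprK (\pi_(orbit_space H) x).
have : fingroup.repr (coset H g) \in (H :* g)%g.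
  by rewrite -(val_coset gN); exact: mem_repr_coset.
move=> /rcosetP [k kH ->].
exists ((k^-1 * h) ^ g)%g.
  by rewrite memJ_norm // groupM // groupV.
rewrite {1}xE -!actTM conjgE; congr (to _ _).
by rewrite -!mulgA mulKVg mulKVg.
Qed.

Lemma orbit_space_act1 (H : {group gT}) (z : orbit_space H) :
  orbit_space_act z 1%g = z.
Proof.
by rewrite -[z]reprK -(coset_id (group1 H)) orbit_space_actE ?group1 // actT1.
Qed.

Lemma orbit_space_actM (H : {group gT}) (z : orbit_space H) :
  act_morph (@orbit_space_act H) z.
Proof.
move=> a b; case: (cosetP a) => x xN ->; case: (cosetP b) => y yN ->.
rewrite -[z]reprK -morphM // orbit_space_actE ?groupM //.
by rewrite (orbit_space_actE _ xN) (orbit_space_actE _ yN) actTM.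
Qed.

Definition orbit_space_pull (H : {group gT}) (aT : finGroupType)
    (phi : {morphism [set: aT]%SET >-> coset_of H}) (z : orbit_space H) (g : aT) :=
  orbit_space_act z (phi g).

Lemma orbit_space_pull1 (H : {group gT}) (aT : finGroupType)
  (phi : {morphism [set: aT]%SET >-> coset_of H}) :
  (orbit_space_pull phi)^~ 1%g =1 id.
Proof.
by move=> z; rewrite /orbit_space_pull morph1 orbit_space_act1.
Qed.

Lemma orbit_space_pullM (H : {group gT}) (aT : finGroupType)
  (phi : {morphism [set: aT]%SET >-> coset_of H}) z :
  act_morph (orbit_space_pull phi) z.
Proof.
move=> a b; rewrite /orbit_space_pull morphM ?inE //.
exact: orbit_space_actM.
Qed.

Definition orbit_space_action (H : {group gT}) (aT : finGroupType)
    (phi : {morphism [set: aT]%SET >-> coset_of H}) :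
    {action aT &-> orbit_space H} :=
  TotalAction (orbit_space_pull1 phi) (orbit_space_pullM phi).

End OrbitSpace.

Section Polytope.
Variables (R : realType) (N : nat).
Implicit Types (A P : set 'rV[R]_N) (n k : nat).

Definition convex_hull k (v : 'I_k -> 'rV[R]_N) : set 'rV[R]_N :=
  [set x | exists c : 'I_k -> R,
    [/\ forall i, 0 <= c i, \sum_i c i = 1 & x = \sum_i c i *: v i]].

Definition polytope P : Prop :=
  exists k (v : 'I_k -> 'rV[R]_N), P = convex_hull v.

(* The affine hull of A has dimension k: the rows of B are differences of
   points of A and form a basis of its direction. *)
Definition affine_dim A k : Prop :=
  exists (x0 : 'rV[R]_N) (B : 'M[R]_(k, N)),
    [/\ A x0, row_free B, forall i, A (x0 + row i B) &
        forall x, A x -> (x - x0 <= B)%MS].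

Definition face P A : Prop :=
  exists (a : 'cV[R]_N) (b : R),
    (forall x, P x -> (x *m a) 0 0 <= b) /\
    A = P `&` [set x | (x *m a) 0 0 = b].

Definition facet n P : set (set 'rV[R]_N) :=
  [set A | exists k, [/\ n = k.+1, face P A & affine_dim A k]].

Definition facets_at n P (x : 'rV[R]_N) : set (set 'rV[R]_N) :=
  [set A | facet n P A /\ A x].

Definition simple_polytope n P : Prop :=
  [/\ polytope P, affine_dim P n &
      forall v, face P [set v] -> facets_at n P v #= `I_n].

End Polytope.

Section RealMomentAngle.
Variables (R : realType) (N d : nat).
Variables (P : set 'rV[R]_N) (F : 'I_d -> set 'rV[R]_N).

Definition rma_cover : Type := (P * discrete_topology (Z2 d))%type.
HB.instance Definition _ := Topological.on rma_cover.

Definition rma_rel (x y : rma_cover) : Prop :=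
  exists2 i, F i (set_val x.1) &
    y = (x.1, (x.2 : Z2 d) + delta_mx 0 i).

Definition real_moment_angle : Type := quot rma_rel.
HB.instance Definition _ := Topological.on real_moment_angle.
HB.instance Definition _ := Quotient.on real_moment_angle.

Definition rma_pt (x : P) (g : Z2 d) : real_moment_angle :=
  \pi_real_moment_angle (x, g).

Definition rma_act (z : real_moment_angle) (g : Z2 d) : real_moment_angle :=
  rma_pt (repr z).1 (g + (repr z).2).

Lemma rma_actE x g g0 : rma_act (rma_pt x g) g0 = rma_pt x (g0 + g).
Proof.
pose f (u : rma_cover) := rma_pt u.1 (g0 + (u.2 : Z2 d)).
suff fE u v : clos_refl_sym_trans _ rma_rel u v -> f u = f v.
  by symmetry; exact: (fE (x, g) _ (quot_repr _ _)).
apply: quot_ind2 => {}u {}v [i Fi ->]; rewrite /f /rma_pt /=.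
by apply/quotP/rst_step; exists i => //=; rewrite addrA.
Qed.

Lemma rma_ptW (z : real_moment_angle) : exists x g, z = rma_pt x g.
Proof.
exists (repr z).1, (repr z).2; rewrite -{1}[z]reprK /rma_pt.
by case: (repr z).
Qed.

Lemma rma_act1 : rma_act^~ 1%g =1 id.
Proof. by move=> z; have [x [g ->]] := rma_ptW z; rewrite rma_actE add0r. Qed.

Lemma rma_actM z : act_morph rma_act z.
Proof.
move=> a b; have [x [g ->]] := rma_ptW z; rewrite !rma_actE.
by rewrite [(a * b)%g]addrC addrA.
Qed.

Definition canonical_action : {action Z2 d &-> real_moment_angle} :=
  TotalAction rma_act1 rma_actM.

End RealMomentAngle.

Section SmallCover.
Variables (R : realType) (n : nat).

(* f is C^oo on W (to be used with W open): all the iterated directional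
   derivatives of f exist and are continuous at the points of W. *)
Definition smooth_on (W : set 'rV[R]_n) (f : 'rV[R]_n -> 'rV[R]_n) : Prop :=
  forall (vs : seq 'rV[R]_n) (x : 'rV[R]_n), W x ->
    let Df : 'rV[R]_n -> 'rV[R]_n := foldr (fun v g => 'D_v g) f vs in
    {for x, continuous Df} /\ forall v, derivable Df x v.

Definition closed_smooth_manifold (X : topologicalType) : Prop :=
  [/\ compact [set: X], hausdorff_space X, @second_countable X &
      exists (I : Type) (U : I -> set X) (V : I -> set 'rV[R]_n)
             (phi : I -> X -> 'rV[R]_n) (psi : I -> 'rV[R]_n -> X),
        [/\ forall i, open_homeo (U i) (V i) (phi i) (psi i),
            forall x, exists i, U i x &
            forall i j, smooth_on (V i `&` psi i @^-1` U j) (phi j \o psi i)]].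

Definition reflect_coords (g : Z2 n) (v : 'rV[R]_n) : 'rV[R]_n :=
  \row_i ((-1) ^+ (g 0 i) * v 0 i).

Variables (X : topologicalType) (to : {action Z2 n &-> X}).

(* A chart identifying the action on an invariant open set of X with the
   standard one on an invariant open set of R^n, up to an automorphism of
   (Z/2)^n. *)
Definition standard_chart (U : set X) (V : set 'rV[R]_n)
    (phi : X -> 'rV[R]_n) (psi : 'rV[R]_n -> X) : Prop :=
  [/\ open_homeo U V phi psi,
      forall x g, U x -> U (to x g),
      forall v g, V v -> V (reflect_coords g v) &
      exists2 sigma, sigma \in Aut [set: Z2 n]%SET &
        forall x g, U x -> phi (to x g) = reflect_coords (sigma g) (phi x)].

Definition locally_standard : Prop :=
  continuous_action to /\
  forall x, exists U V phi psi, standard_chart U V phi psi /\ U x.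

(* The orbit space of the standard action on R^n is the orthant, a manifold
   with corners. The codimension of the corner below x is the number of
   coordinates of x that vanish in a standard chart. *)
Definition corner_codim (x : X) (k : nat) : Prop :=
  exists U V phi psi,
    [/\ standard_chart U V phi psi, U x & #|[pred j | phi x 0 j == 0]| = k].

(* The orbit space is P as a manifold with corners, i.e. through a
   homeomorphism that respects the codimension of the corners, which at a point
   of a simple polytope is the number of facets through it. *)
Definition orbit_space_is (N : nat) (P : set 'rV[R]_N) : Prop :=
  exists h : orbit_space to [set: Z2 n]%G -> P,
    homeomorphism h /\
    forall x k, corner_codim x k ->
      facets_at n P (set_val (h (\pi_(orbit_space to [set: Z2 n]%G) x))) #= `I_k.

Definition small_cover (N : nat) (P : set 'rV[R]_N) : Prop :=
  [/\ closed_smooth_manifold X, locally_standard & orbit_space_is P].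

End SmallCover.

Section PrincipalBundle.
Variables (m : nat) (Q : topologicalType).

Definition principal_bundle (M : topologicalType)
    (to : {action Z2 m &-> M}) (p : M -> Q) : Prop :=
  [/\ continuous_action to, continuous p &
      forall q, exists (U : set Q) (t : M -> Z2 m)
                       (s : Q * discrete_topology (Z2 m) -> M),
        [/\ open U, U q,
            open_homeo (p @^-1` U) (U `*` [set: discrete_topology (Z2 m)])
              (fun x => (p x, t x : discrete_topology (Z2 m))) s &
            forall x g, U (p x) -> p (to x g) = p x /\ t (to x g) = t x + g]].

Definition bundle_equivalent (M1 M2 : topologicalType)
    (to1 : {action Z2 m &-> M1}) (p1 : M1 -> Q)
    (to2 : {action Z2 m &-> M2}) (p2 : M2 -> Q) : Prop :=
  exists (f : M1 -> M2) (sigma : {perm Z2 m}),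
    [/\ homeomorphism f, sigma \in Aut [set: Z2 m]%SET,
        forall x g, f (to1 x g) = to2 (f x) (sigma g) &
        forall x, p2 (f x) = p1 x].

End PrincipalBundle.

(* Main.v *)
Require Import Defs.
From Stdlib Require Import Relation_Operators.
From mathcomp Require Import all_boot all_order all_algebra all_fingroup.
From mathcomp Require Import generic_quotient lra.
From mathcomp Require Import all_classical all_reals all_analysis.

(* Let q : Q -> P be the orbit map. As P is convex, q has a continuous section s,
   each translate g s of s lifts to a map sig g : P -> M, and all the lifts may be
   made to agree at a vertex of P. Over a facet F i, whose isotropy group is
   generated by lam i, the lifts sig (g + lam i) and sig g differ by an element
   c g i of (Z/2)^m, and (y, a) |-> sig (sum a_i lam i) y + sum a_i c_i induces an
   equivariant map from the real moment-angle manifold onto M provided that c g i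
   does not depend on g. The values of c at codimension 2 faces satisfy a cocycle
   relation, so that at a vertex where all but one of the c _ i are constant the
   last one is constant too. Ordering the facets by the minimum of a generic linear
   functional, this propagates from one vertex to all facets: every other vertex
   has an edge along which the functional decreases, and the n - 1 facets
   containing it come earlier. *)

Set Implicit Arguments.
Unset Strict Implicit.
Unset Printing Implicit Defensive.

Import Order.TTheory GRing.Theory Num.Theory.
Import numFieldNormedType.Exports.

Local Open Scope classical_set_scope.
Local Open Scope ring_scope.
Local Open Scope quotient_scope.
Local Open Scope card_scope.

(** Let [L] and [C] be the matrices with rows lam i and c_i. The groups of the theorem are [Ht], the
    vectors killed by [L], and [H], those killed by both [L] and [C]. That [Ht / H] is all of
    (Z/2)^m is where connectedness enters: [M] is a finite union of closed copies of [P] indexed by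
    (Z/2)^n x (Z/2)^m, and the copies with index in the image of a |-> (a L, a C) never meet the
    others, so this map is onto. Freeness of [Ht] comes from the independence of the lam i at each
    point of [P]. Convexity stands in for simple connectedness: the group element comparing two
    sections or lifts is locally constant, hence constant, and this uniqueness is also what allows
    local choices to be glued. The action on [Q] is not free, so sections of q are compared over the
    interior of [P] first and then by density. Nothing local is verified on the quotients of the
    moment-angle manifold: they are compact and the targets Hausdorff, so continuous bijections are
    homeomorphisms, and the bundle structure is transported from [M]. *)

Lemma cvg_near (T : Type) (U : topologicalType) (F : set_system T)
    (f : T -> U) (l : U) (Q : U -> Prop) :
  f @ F --> l -> (\forall u \near l, Q u) -> \forall t \near F, Q (f t).
Proof. by move=> fl; apply: fl. Qed.

(** * Convex sets and gluing of local sections *)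

Section Convex.
Variables (R : realType) (N : nat).
Implicit Types (A P D : set 'rV[R]_N).

Definition convex A := forall x y t, A x -> A y -> 0 <= t <= 1 ->
  A ((1 - t) *: x + t *: y).

Lemma convexI A D : convex A -> convex D -> convex (A `&` D).
Proof. by move=> Ac Dc x y t [Ax Dx] [Ay Dy] t01; split; [apply: Ac|apply: Dc]. Qed.

(** Along the segment from [x] to [y], the parameters at which [c] keeps its value at [x] form a
    relatively open and closed subset of [0, 1]. The target [T] carries no topology. *)
Lemma convex_locally_constant A (T : Type) (c : 'rV[R]_N -> T) :
  convex A -> (forall x, A x -> \forall y \near x, A y -> c y = c x) ->
  forall x y, A x -> A y -> c y = c x.
Proof.
move=> Ac cloc x y Ax Ay.
pose g (t : R) := (1 - t) *: x + t *: y.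
have gc : continuous g.
  move=> t; apply: cvgD; apply: cvgZr_tmp.
    by apply: cvgB; [exact: cvg_cst|exact: cvg_id].
  exact: cvg_id.
pose I : set R := [set` `[0, 1]].
have gA t : I t -> A (g t) by rewrite /I /= in_itv /=; exact: Ac.
have gloc t : I t -> \forall u \near t, I u -> c (g u) = c (g t).
  move=> /gA At; apply: filterS (cvg_near (gc t) (cloc _ At)) => u /= h /gA; exact: h.
pose B := [set t | I t /\ c (g t) = c x].
suff BE : B = I.
  have : B 1 by rewrite BE /I /= in_itv /= ler01 lexx.
  by move=> [_]; rewrite /g subrr scale0r add0r scale1r.
apply: (@segment_connected R 0 1).
- exists 0; split; first by rewrite /I /= in_itv /= ler01 lexx.
  by rewrite /g subr0 scale1r scale0r addr0.
- exists [set t | \forall u \near t, I u -> c (g u) = c x].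
    exact: open_interior.
  apply/seteqP; split=> [t [It ct]|t [It /nbhs_singleton ct]].
    by split=> //; have := gloc t It; rewrite ct.
  by split=> //; exact: ct.
- exists (~` [set t | \forall u \near t, I u -> c (g u) <> c x]).
    exact/open_closedC/open_interior.
  apply/seteqP; split=> [t [It ct]|t [It nt]].
    by split=> // /nbhs_singleton; apply.
  split=> //; apply: contrapT => ct; apply: nt.
  have := gloc t It; apply: filterS => u /= h Iu; by rewrite h.
Qed.

End Convex.

Section Glue.
Variables (R : realType) (N : nat) (P : set 'rV[R]_N) (E G : Type).
Variables (act : E -> G -> E) (S : ('rV[R]_N -> E) -> 'rV[R]_N -> Prop).
Hypothesis S_local : forall f f' x, P x ->
  (\forall y \near x, P y -> f y = f' y) -> S f x -> S f' x.
Hypothesis S_act : forall f x g, P x -> S f x -> S (fun y => act (f y) g) x.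
Hypothesis S_uniq : forall D f1 f2, convex D -> open D ->
  (forall x, D x -> P x -> S f1 x /\ S f2 x) ->
  exists g, forall x, D x -> P x -> f1 x = act (f2 x) g.

Let good (D : set 'rV[R]_N) := exists f, forall x, D x -> P x -> S f x.

Let good_sub D D' : (forall x, P x -> D x -> D' x) -> good D' -> good D.
Proof. by move=> s [f fP]; exists f => x Dx Px; apply: fP => //; apply: s. Qed.

(** The overlap is again convex and open, so [S_uniq] gives a single element matching the two
    sections there, and one of them is moved by it. *)
Let goodU D D' : convex D -> open D -> convex D' -> open D' ->
  good D -> good D' -> good (D `|` D').
Proof.
move=> Dc Do D'c D'o [f fS] [f' f'S].
have [|x [Dx D'x] Px|g gP] := @S_uniq (D `&` D') f f' (convexI Dc D'c).
- exact: openI.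
- by split; [exact: fS|exact: f'S].
exists (fun x => if `[< D x >] then f x else act (f' x) g).
move=> x [Dx|D'x] Px.
- apply: (@S_local f); [by []| |exact: fS].
  have : nbhs x D by exact: open_nbhs_nbhs.
  by apply: filterS => y Dy _; rewrite asboolT.
- apply: (@S_local (fun x => act (f' x) g)); [by []| |exact/S_act/f'S].
  have : nbhs x D' by exact: open_nbhs_nbhs.
  by apply: filterS => y D'y Py; case: asboolP => // Dy; rewrite gP.
Qed.

(** For [k = 0] all points of [D] in [P] are within sup-distance [d] of each other; for [k >= N] the
    condition is void. *)
Let thin (d : R) (k : nat) (D : set 'rV[R]_N) := forall (i : 'I_N) x y, (k <= i)%N ->
  D x -> D y -> P x -> P y -> x 0 i - y 0 i < d.

Let slab_lt D (i : 'I_N) c : convex D -> open D ->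
  convex (D `&` [set x : 'rV[R]_N | x 0 i < c]) /\ open (D `&` [set x : 'rV[R]_N | x 0 i < c]).
Proof.
move=> Dc Do; split.
  apply: convexI => // x y t /= xc yc /andP[t0 t1]; rewrite !mxE.
  by have [xy|yx] := leP (x 0 i) (y 0 i); nra.
apply: openI => //; apply: (@open_comp _ _ (fun x : 'rV[R]_N => x 0 i) [set r | r < c]).
  by move=> x _; exact: coord_continuous.
exact: open_lt.
Qed.

Let slab_gt D (i : 'I_N) c : convex D -> open D ->
  convex (D `&` [set x : 'rV[R]_N | c < x 0 i]) /\ open (D `&` [set x : 'rV[R]_N | c < x 0 i]).
Proof.
move=> Dc Do; split.
  apply: convexI => // x y t /= xc yc /andP[t0 t1]; rewrite !mxE.
  by have [xy|yx] := leP (x 0 i) (y 0 i); nra.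
apply: openI => //; apply: (@open_comp _ _ (fun x : 'rV[R]_N => x 0 i) [set r | c < r]).
  by move=> x _; exact: coord_continuous.
exact: open_gt.
Qed.

(* Induction on the number of coordinates along which [D] may be thick; a
   coordinate is dealt with by cutting [D] into overlapping slabs. *)
Let thin_good d : 0 < d -> bounded_set P ->
  (forall D, convex D -> open D -> thin d 0 D -> good D) ->
  forall k D, convex D -> open D -> thin d k D -> good D.
Proof.
move=> d0 [M [_ PM]] base; elim=> [|k IHk] // D Dc Do Dt.
have [kN|Nk] := ltnP k N; last first.
  by apply: IHk => // i x y ki; have := ltn_ord i; rewrite ltnNge (leq_trans Nk ki).
pose i0 := Ordinal kN.
have {}PM x : P x -> - (`|M| + 2) < x 0 i0 < `|M| + 2.
  move=> /(PM (`|M| + 1)) xM; have {}xM : `|x| <= `|M| + 1.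
    by apply: xM; rewrite (le_lt_trans (ler_norm M)) // ltrDl.
  have : `|x 0 i0| <= `|M| + 1.
    apply: le_trans xM; rewrite [leRHS]/Num.norm /= mx_normrE.
    by apply/bigmax_geP; right => /=; exists (0, i0).
  rewrite ler_norml => /andP[]; lra.
(* Slabs have width [2 * r = d] and start at multiples of [r], so consecutive ones overlap in a
   strip of width [r]. The induction on [e] adds one strip at a time above the lower bound [lo]. *)
pose lo := - (`|M| + 2); pose r := d / 2.
suff H e : forall D, convex D -> open D -> thin d k.+1 D ->
    (forall x, D x -> P x -> x 0 i0 < lo + e%:R * r) -> good D.
  pose b := (`|M| *+ 2 + 4) / r.
  have r0 : 0 < r by rewrite divr_gt0.
  have b0 : 0 <= b by rewrite divr_ge0 ?ltW // addr_gt0 // ltr_wpDl // mulrn_wge0.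
  apply: (H (Num.bound b)) => // x _ /PM /andP[_ /lt_le_trans]; apply.
  have /ltW := archi_boundP b0.
  rewrite -(ler_pM2r r0) /b divfK ?gt_eqF // => h.
  by rewrite -lerBlDl (le_trans _ h) // /lo; lra.
elim: e => [|e IHe] {Dc Do Dt}D Dc Do Dt De.
  (* For [e = 0] the set [D] misses [P], so thinness holds vacuously. *)
  apply: IHk => // i x y _ Dx _ Px _; have := De x Dx Px.
  by have /andP[+ _] := PM x Px; rewrite /lo; lra.
have [D1c D1o] := slab_lt i0 (lo + e%:R * r) Dc Do.
have [D2c D2o] := slab_gt i0 (lo + (e%:R - 1) * r) Dc Do.
apply: (@good_sub _ ((D `&` [set x : 'rV[R]_N | x 0 i0 < lo + e%:R * r]) `|`
   (D `&` [set x : 'rV[R]_N | lo + (e%:R - 1) * r < x 0 i0]))).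
  move=> x Px Dx; have [xlt|xge] := ltP (x 0 i0) (lo + e%:R * r); first by left.
  by right; split=> //=; apply: lt_le_trans xge; rewrite /r; lra.
apply: goodU => //.
  apply: IHe => // [|x [] //].
  by move=> i x y ki [Dx _] [Dy _]; exact: Dt.
apply: IHk => // i x y ki [Dx xlo] [Dy ylo] Px Py.
have [ik|ik] := eqVneq i i0.
  move: xlo ylo (De x Dx Px) (De y Dy Py); rewrite ik /= /r -[e.+1%:R]natr1; lra.
apply: Dt => //; rewrite ltn_neqAle ki andbT; apply: contra ik => /eqP ki0.
by apply/eqP/val_inj.
Qed.

(** Here [S f x] is to be read as: [f] is an admissible section at [x]. The lemma serves twice, for
    sections of the orbit map and for lifts to the bundle. Compactness provides one radius for all
    local sections, and [thin_good] assembles the pieces. *)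
Lemma glue_sections : compact P -> P !=set0 ->
  (forall x, P x -> exists f, \forall y \near x, P y -> S f y) ->
  exists f, forall x, P x -> S f x.
Proof.
move=> Pk [x0 Px0] loc.
pose Q (e : R) (x : 'rV[R]_N) := good (ball x e).
have QP x : P x -> \forall x' \near x & e \near 0^'+, Q e x'.
  move=> /loc [f /nbhs_ballP [e /= e0 fS]].
  exists (ball x (e / 2), [set r | 0 < r < e / 2]) => /=.
    split; first by apply: nbhsx_ballx; rewrite divr_gt0.
    near=> r; apply/andP; split; first by near: r; exact: nbhs_right_gt.
    by near: r; apply: nbhs_right_lt; rewrite divr_gt0.
  move=> [y r] /= [xy /andP[r0 re]]; exists f => z yz Pz; apply: fS => //.
  by apply: (@ball_split _ _ y) => //; apply: le_ball yz; exact: ltW.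
(* A Lebesgue number for the domains of the local sections. *)
have [e [e0 Qe]] : exists e : R, 0 < e /\ P `<=` Q e.
  have H := (compact_near_coveringP P).1 Pk R 0^'+ Q _ QP.
  have : \forall e \near (0 : R)^'+, 0 < e /\ P `<=` Q e.
    by near=> e; split; [near: e; exact: nbhs_right_gt|near: e; exact: H].
  by move=> /filter_ex.
have [f0 f0S] := loc x0 Px0.
suff [f fS] : good [set: 'rV[R]_N] by exists f => x; exact: fS.
apply: (@thin_good e e0 (compact_bounded Pk) _ N).
- move=> D Dc Do Dt.
  have [[x [Dx Px]]|D0] := pselect (D `&` P !=set0).
    apply: good_sub (Qe x Px) => y Py Dy; split=> // i j; rewrite ord1.
    rewrite /ball /= ltr_norml; have := Dt j x y isT Dx Dy Px Py.
    have := Dt j y x isT Dy Dx Py Px; lra.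
  by exists f0 => x Dx Px; case: D0; exists x.
- by move=> x y t _ _ _.
- exact: openT.
- by move=> i x y; rewrite leqNgt ltn_ord.
Unshelve. all: by end_near. Qed.

End Glue.

Lemma near_neq (T : Type) (X : topologicalType) (F : set_system T)
    (f g : T -> X) (a b : X) : hausdorff_space X -> Filter F ->
  f @ F --> a -> g @ F --> b -> a <> b -> \forall t \near F, f t <> g t.
Proof.
rewrite open_hausdorff => Xh FF fa gb /eqP /Xh [[A B]] /= [].
rewrite !inE => Aa Bb [Ao Bo AB].
have := cvg_near fa (open_nbhs_nbhs (conj Ao Aa)).
apply: filterS2 (cvg_near gb (open_nbhs_nbhs (conj Bo Bb))) => t Bt At fg.
by have : set0 (f t) by rewrite -AB; split=> //; rewrite fg.
Qed.

Section SectionUniqueness.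
Variables (R : realType) (N : nat) (X : topologicalType) (gT : finGroupType).
Variable (to : {action gT &-> X}).

(** Freeness makes the comparing element at each point unique. The finitely many other elements fail
    at [x], hence near [x] since [X] is Hausdorff, so the comparing element is locally constant on
    the convex set [A]. Freeness is asked only along [f2], which permits actions that are free over
    part of the space. *)
Lemma free_orbit_unique (A : set 'rV[R]_N) (f1 f2 : 'rV[R]_N -> X) :
  hausdorff_space X -> continuous_action to -> convex A ->
  (forall x, A x -> f1 @ within A (nbhs x) --> f1 x) ->
  (forall x, A x -> f2 @ within A (nbhs x) --> f2 x) ->
  (forall x, A x -> exists g, f1 x = to (f2 x) g) ->
  (forall x g, A x -> to (f2 x) g = f2 x -> g = 1%g) ->
  exists g, forall x, A x -> f1 x = to (f2 x) g.
Proof.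
move=> Xh toc Ac f1c f2c orb free.
have /choice [c cP] : forall x, exists g, A x -> f1 x = to (f2 x) g.
  by move=> x; have [/orb[g ?]|nAx] := pselect (A x); [exists g|exists 1%g].
have cloc x : A x -> \forall y \near x, A y -> c y = c x.
  move=> Ax.
  have : \forall y \near within A (nbhs x), forall g, g != c x -> f1 y <> to (f2 y) g.
    apply: filter_forall => g.
    have [gc|gc] := eqVneq g (c x); first by apply: filterE => ?.
    have : \forall y \near within A (nbhs x), f1 y <> to (f2 y) g.
      apply: (@near_neq _ _ (within A (nbhs x)) f1 (fun y => to (f2 y) g) _
        (to (f2 x) g) Xh _ (f1c x Ax)).
        by apply: (cvg_comp _ (fun z => to z g) (f2c x Ax)); exact: toc.
      rewrite (cP x Ax) => eqg; move/eqP: gc; apply.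
      have : to (to (f2 x) g) (c x)^-1%g = f2 x by rewrite -eqg actTK.
      by rewrite -actTM => /(free _ _ Ax) /eqP; rewrite -eq_mulgV1 => /eqP.
    by apply: filterS => y.
  rewrite near_withinE; apply: filterS => y h Ay.
  by apply: contrapT => /eqP cne; exact: (h Ay _ cne (cP y Ay)).
have [[x Ax]|A0] := pselect (A !=set0); last first.
  by exists 1%g => x Ax; case: A0; exists x.
exists (c x) => y Ay; rewrite {1}(cP y Ay).
by rewrite (convex_locally_constant Ac cloc Ax Ay).
Qed.

End SectionUniqueness.

(** * Linear functionals and general position *)

Section Functional.
Variables (R : realType) (N : nat).
Implicit Types (x y : 'rV[R]_N) (a : 'cV[R]_N).

Definition lform x a : R := (x *m a) 0 0.

Lemma lformE x a : lform x a = \sum_j x 0 j * a j 0.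
Proof. by rewrite /lform mxE. Qed.

Lemma lformD x y a : lform (x + y) a = lform x a + lform y a.
Proof. by rewrite /lform mulmxDl mxE. Qed.

Lemma lformZ t x a : lform (t *: x) a = t * lform x a.
Proof. by rewrite /lform -scalemxAl mxE. Qed.

Lemma lformB x y a : lform (x - y) a = lform x a - lform y a.
Proof. by rewrite lformD -scaleN1r lformZ mulN1r. Qed.

Lemma lform_sum I r (p : pred I) (F : I -> 'rV[R]_N) a :
  lform (\sum_(i <- r | p i) F i) a = \sum_(i <- r | p i) lform (F i) a.
Proof. by rewrite /lform mulmx_suml summxE. Qed.

Lemma lformDr x a b : lform x (a + b) = lform x a + lform x b.
Proof. by rewrite /lform mulmxDr mxE. Qed.

Lemma lformZr t x a : lform x (t *: a) = t * lform x a.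
Proof. by rewrite /lform -scalemxAr mxE. Qed.

Lemma lform_continuous a : continuous (fun x => lform x a).
Proof.
rewrite (_ : (fun x => _) = fun x => \sum_(j < N) x 0 j * a j 0).
  apply: (@continuous_big R 'I_N +%R 0 xpredT _ 'rV[R]_N (index_enum _)
    (fun j (x : 'rV[R]_N) => x 0 j * a j 0)).
    exact: add_continuous.
  move=> j _ x; have := @coord_continuous R 1 N 0 j x.
  exact: (@cvgMr_tmp _ _ (nbhs x)).
by apply/funext => x; rewrite lformE.
Qed.

(** The functional is a point (1, t, t^2, ...) of the moment curve: on a nonzero difference
    [V i - V j] it takes the value at [t] of a nonzero polynomial. It remains to choose [t] off the
    roots of the product of these polynomials. *)
Lemma generic_functional (I : finType) (V : I -> 'rV[R]_N) :
  exists a, forall i j, lform (V i) a = lform (V j) a -> V i = V j.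
Proof.
pose p := \prod_(ij : I * I | V ij.1 != V ij.2) rVpoly (V ij.1 - V ij.2).
have p0 : p != 0.
  apply/prodf_neq0 => -[i j] /= ij; apply: contra ij => /eqP ij0.
  by rewrite -subr_eq0 -[_ - _]rVpolyK ij0 linear0.
have [t pt] : exists t, ~~ root p t.
  apply/not_existsP => h.
  pose rs : seq R := [seq i%:R | i <- iota 0 (size p)].
  have : (size rs < size p)%N.
    apply: max_poly_roots => //; first by apply/allP => t _; apply/negPn/negP; exact: h.
    by rewrite map_inj_uniq ?iota_uniq // => i j /eqP; rewrite eqr_nat => /eqP.
  by rewrite size_map size_iota ltnn.
exists (\col_k t ^+ k) => i j; apply: contraPP => /eqP ij.
apply/eqP; rewrite -subr_eq0 -lformB.
apply: contra pt; rewrite rootE horner_prod => ev0.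
rewrite (bigD1 (i, j)) //= /rVpoly horner_poly.
rewrite mulf_eq0; apply/orP; left; apply: etrans ev0; congr (_ == _).
rewrite lformE; apply: eq_bigr => k _; rewrite insubT ?ltn_ord // => kN; rewrite !mxE.
by congr (_ * _); congr (V i 0 _ - V j 0 _); exact: val_inj.
Qed.

End Functional.

(** * Polytopes *)

Section Polytopes.
Variables (R : realType) (N : nat).
Implicit Types (A P : set 'rV[R]_N).

Lemma convex_hull_convex k (V : 'I_k -> 'rV[R]_N) : convex (convex_hull V).
Proof.
move=> _ _ t [c [c0 c1 ->]] [e [e0 e1 ->]] /andP[t0 t1].
exists (fun i => (1 - t) * c i + t * e i); split.
- by move=> i; rewrite addr_ge0 // mulr_ge0 // subr_ge0.
- by rewrite big_split /= -!mulr_sumr c1 e1 !mulr1 subrK.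
- rewrite !scaler_sumr -big_split /=; apply: eq_bigr => i _.
  by rewrite [RHS]scalerDl !scalerA.
Qed.

Lemma convex_hull_vertex k (V : 'I_k -> 'rV[R]_N) i : convex_hull V (V i).
Proof.
exists (fun j => (j == i)%:R); split.
- by move=> j; rewrite ler0n.
- by rewrite (bigD1 i) //= eqxx big1 ?addr0 // => j /negPf ->.
- by rewrite (bigD1 i) //= eqxx scale1r big1 ?addr0 // => j /negPf ->; rewrite scale0r.
Qed.

Lemma polytope_convex P : polytope P -> convex P.
Proof. by move=> [k [V ->]]; exact: convex_hull_convex. Qed.

(** The hull is a continuous image of the standard simplex, which is closed and bounded. *)
Lemma polytope_compact P : polytope P -> compact P.
Proof.
move=> [k [V ->]].
pose D := [set c : 'rV[R]_k | (forall i, 0 <= c 0 i) /\ \sum_i c 0 i = 1].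
pose f (c : 'rV[R]_k) := \sum_i c 0 i *: V i.
have -> : convex_hull V = f @` D.
  apply/seteqP; split=> [_ [c [c0 c1 ->]]|_ [c [c0 c1] <-]].
    exists (\row_i c i); first split.
    - by move=> i; rewrite mxE.
    - by rewrite -c1; apply: eq_bigr => i _; rewrite mxE.
    - by apply: eq_bigr => i _; rewrite mxE.
  by exists (fun i => c 0 i).
have sumc : continuous (fun c : 'rV[R]_k => \sum_i c 0 i).
  apply: (@continuous_big R 'I_k +%R 0 xpredT _ 'rV[R]_k (index_enum _)
    (fun i (c : 'rV[R]_k) => c 0 i)); first exact: add_continuous.
  by move=> i _; exact: coord_continuous.
apply: continuous_compact.
  apply: continuous_subspaceT.
  apply: (@continuous_big 'rV[R]_N 'I_k +%R 0 xpredT _ 'rV[R]_k (index_enum _)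
    (fun i (c : 'rV[R]_k) => c 0 i *: V i)); first exact: add_continuous.
  move=> i _ x; have := @coord_continuous R 1 k 0 i x.
  exact: (@cvgZr_tmp _ _ _ (nbhs x)).
apply: bounded_closed_compact.
  exists 1; split; first exact: num_real.
  move=> M M1 c [c0 c1]; change (`|c| <= M); rewrite [leLHS]/Num.norm /= mx_normrE.
  apply/bigmax_leP; split; first by rewrite (le_trans ler01) // ltW.
  move=> [i j] _ /=; rewrite ord1 ger0_norm // (le_trans _ (ltW M1)) // -c1.
  by rewrite (bigD1 j) //= lerDl sumr_ge0.
have -> : D = (\bigcap_i [set c : 'rV[R]_k | 0 <= c 0 i]) `&`
              [set c : 'rV[R]_k | \sum_i c 0 i = 1].
  by apply/seteqP; split=> c [c0 c1]; split=> // i; [move=> _|]; exact: c0.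
apply: closedI.
  apply: closed_bigI => i _.
  apply: (@preimage_closed _ _ (fun c : 'rV[R]_k => c 0 i) [set r | 0 <= r]).
    by move=> c _; exact: coord_continuous.
  exact: closed_ge.
apply: (@preimage_closed _ _ (fun c : 'rV[R]_k => \sum_i c 0 i) [set r | r = 1]).
  by move=> c _; exact: sumc.
exact: closed_eq.
Qed.

Lemma face_extreme P A x y t : face P A -> P x -> P y -> 0 < t < 1 ->
  A ((1 - t) *: x + t *: y) -> A x /\ A y.
Proof.
move=> [a [b [Pab ->]]] Px Py /andP[t0 t1] [_ /=].
rewrite -![(_ *m a) 0 0]/(lform _ a) lformD !lformZ => e.
have xb : lform x a <= b by exact: Pab.
have yb : lform y a <= b by exact: Pab.
by split; split=> //=; apply/eqP; rewrite eq_le -/(lform _ a) ?xb ?yb /=; nra.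
Qed.

Lemma face_convex P A : convex P -> face P A -> convex A.
Proof.
move=> Pc [a [b [Pab ->]]] x y t [Px /= xa] [Py /= ya] t01.
split; first exact: Pc.
move: xa ya; rewrite /= -![(_ *m a) 0 0]/(lform _ a) lformD !lformZ => -> ->.
by rewrite -mulrDl subrK mul1r.
Qed.

Lemma face_sub P A : face P A -> A `<=` P.
Proof. by move=> [a [b [_ ->]]] x []. Qed.

Lemma face_closed P A : closed P -> face P A -> closed A.
Proof.
move=> Pc [a [b [_ ->]]]; apply: closedI => //.
apply: (@preimage_closed _ _ (fun x => lform x a) [set r | r = b]).
  by move=> x _; exact: lform_continuous.
exact: closed_eq.
Qed.

(** If a point strictly inside a segment lies on [F i], then so do both ends by [face_extreme].
    These strata include the interior of [P] and the relative interiors of its facets, over which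
    isotropy and sections are compared. *)
Lemma stratum_convex P (I : Type) (F : I -> set 'rV[R]_N) (J : set I) :
  convex P -> (forall i, face P (F i)) ->
  convex [set x | P x /\ forall i, F i x <-> J i].
Proof.
move=> Pc Ff x y t [Px Jx] [Py Jy] t01; split; first exact: Pc.
move=> i; split=> [Fi|/[dup] /Jx Fx /Jy Fy]; last exact: face_convex (Ff i) _ _ _ Fx Fy t01.
move: t01 => /andP[t0 t1]; move: t0 t1; rewrite le_eqVlt => /predU1P[t0 _|t0].
  by apply: (Jx i).1; move: Fi; rewrite -t0 subr0 scale1r scale0r addr0.
rewrite le_eqVlt => /predU1P[t1|t1].
  by apply: (Jy i).1; move: Fi; rewrite t1 subrr scale0r add0r scale1r.
by apply: (Jx i).1; have [] := face_extreme (Ff i) Px Py _ Fi; rewrite ?t0.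
Qed.

(* A small perturbation of the functional exposing the face [A] exposes the
   vertex of [A] at which a generic functional is minimal. *)
Lemma face_min_vertex P A k (V : 'I_k -> 'rV[R]_N) l :
  P = convex_hull V -> (forall i j, lform (V i) l = lform (V j) l -> V i = V j) ->
  face P A -> A !=set0 ->
  exists i, [/\ A (V i), forall x, A x -> lform (V i) l <= lform x l &
    face P [set V i]].
Proof.
move=> PE l_inj [a [b [Pab AE]]] [x0 Ax0].
have PV i : P (V i) by rewrite PE; exact: convex_hull_vertex.
have ab i : lform (V i) a <= b by exact: Pab.
have supp c : (forall i, 0 <= c i) -> \sum_i c i = 1 -> A (\sum_i c i *: V i) ->
    forall i, c i != 0 -> lform (V i) a = b.
  move=> c0 c1; rewrite AE => -[_ /=]; rewrite -[(_ *m a) 0 0]/(lform _ a).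
  rewrite lform_sum => e i ci; apply/eqP; rewrite -subr_eq0 -oppr_eq0 opprB.
  have : \sum_i c i * (b - lform (V i) a) = 0.
    under eq_bigr do rewrite mulrBr -lformZ.
    by rewrite sumrB e -mulr_suml c1 mul1r subrr.
  move/eqP; rewrite psumr_eq0; last by move=> j _; rewrite mulr_ge0 // subr_ge0.
  by move=> /allP/(_ i (mem_index_enum _))/=; rewrite mulf_eq0 (negPf ci).
have [i0 i0A] : exists i, lform (V i) a == b.
  have : P x0 by move: Ax0; rewrite AE => -[].
  rewrite PE => -[c [c0 c1 x0E]].
  have [i ci] : exists i, c i != 0.
    apply/not_existsP => h; move: c1; rewrite big1 => [/eqP|i _].
      by rewrite eq_sym oner_eq0.
    by apply/eqP/negPn/negP/h.
  by exists i; apply/eqP; apply: supp ci; rewrite -?x0E.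
have [i /eqP iA imin] :=
  @arg_minP _ _ _ i0 [pred i | lform (V i) a == b] (fun i => lform (V i) l) i0A.
exists i; split.
- by rewrite AE.
- move=> x /[dup] Ax; rewrite {1}AE => -[+ _]; rewrite PE => -[c [c0 c1 xE]].
  rewrite xE lform_sum -[leLHS]mul1r -c1 mulr_suml; apply: ler_sum => j _.
  rewrite lformZ; have [->|cj] := eqVneq (c j) 0; first by rewrite !mul0r.
  apply: ler_wpM2l => //; apply: imin.
  by apply/eqP; apply: supp cj; rewrite -?xE.
(* [K] is so large that [K *: a - l] ranks [V i] strictly above every generator off [A]; on [A] the
   term [- l] decides. The summand 1 makes the estimate [Kgt] strict. *)
- pose K := 1 + \sum_(j | lform (V j) a != b)
      `|lform (V i) l - lform (V j) l| / (b - lform (V j) a).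
  have Kgt j : lform (V j) a != b ->
      lform (V i) l - lform (V j) l < K * (b - lform (V j) a).
    move=> jA; have jb : 0 < b - lform (V j) a by rewrite subr_gt0 lt_neqAle jA ab.
    rewrite -ltr_pdivrMr //.
    apply: (@le_lt_trans _ _ (`|lform (V i) l - lform (V j) l| / (b - lform (V j) a))).
      by rewrite ler_pM2r ?invr_gt0 // ler_norm.
    rewrite /K (bigD1 j) //= addrCA ltrDl ltr_wpDr // sumr_ge0 // => s _.
    by rewrite divr_ge0 // subr_ge0 ab.
  have le_at j : lform (V j) (K *: a - l) <= lform (V i) (K *: a - l) /\
      (lform (V j) (K *: a - l) = lform (V i) (K *: a - l) -> V j = V i).
    rewrite -scaleN1r !lformDr !lformZr !mulN1r iA.
    have [/eqP jA|/Kgt] := eqVneq (lform (V j) a) b.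
      rewrite (eqP jA); split; first by rewrite lerD2l lerN2 imin.
      by move=> /addrI /oppr_inj /l_inj.
    by rewrite mulrBr => h; split; [|move=> e; exfalso]; move: h; [|move: e]; clear; lra.
  exists (K *: a - l), (lform (V i) (K *: a - l)); split.
    move=> x; rewrite PE => -[c [c0 c1 ->]]; rewrite -/(lform _ _) lform_sum.
    rewrite -[leRHS]mul1r -c1 mulr_suml; apply: ler_sum => j _.
    by rewrite lformZ ler_wpM2l // (le_at j).1.
  apply/seteqP; split=> [_ ->|x [+ /=]]; first by split.
  rewrite PE => -[c [c0 c1 xE]]; rewrite -/(lform _ _) xE lform_sum => e.
  rewrite -[RHS]scale1r -c1 scaler_suml; apply: eq_bigr => j _.
  have [->|cj] := eqVneq (c j) 0; first by rewrite !scale0r.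
  rewrite ((le_at j).2 _) //.
  have : \sum_j c j * (lform (V i) (K *: a - l) - lform (V j) (K *: a - l)) = 0.
    under eq_bigr do rewrite mulrBr -[X in _ - X]lformZ.
    by rewrite sumrB e -mulr_suml c1 mul1r subrr.
  move/eqP; rewrite psumr_eq0 => [|s _]; last by rewrite mulr_ge0 // subr_ge0 (le_at s).1.
  move=> /allP/(_ j (mem_index_enum _))/=; rewrite mulf_eq0 (negPf cj) subr_eq0.
  by move=> /eqP.
Qed.

End Polytopes.

Section SimplePolytope.
Variables (R : realType) (N n d : nat) (P : set 'rV[R]_N).
Variable F : 'I_d -> set 'rV[R]_N.
Hypothesis FP : set_bij [set: 'I_d] (facet n P) F.

Definition facets_of (x : 'rV[R]_N) : {set 'I_d} := [set i | `[< F i x >]]%SET.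

Lemma facets_ofP x i : reflect (F i x) (i \in facets_of x).
Proof. by rewrite inE; exact: asboolP. Qed.

Lemma card_facets_of x k : facets_at n P x #= `I_k -> #|facets_of x| = k.
Proof.
move=> Ak; have [Fs Fi Fsurj] := FP.
have FE : facets_at n P x = (F \o @enum_val _ (mem (facets_of x))) @` setT.
  apply/seteqP; split=> [A [/Fsurj[i _ <-] Fix]|_ [i _ <-]].
    have ix : i \in facets_of x by exact/facets_ofP.
    by exists (enum_rank_in ix i) => //=; rewrite enum_rankK_in.
  by split; [exact: Fs|apply/facets_ofP; exact: enum_valP].
apply/card_eq_II; rewrite -(card_eqr Ak) FE card_eq_sym.
rewrite (card_eqr card_II); apply: inj_card_eq => i j _ _ /= /Fi e.
by apply: enum_val_inj; apply: e; rewrite inE.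
Qed.

Lemma facet_face i : face P (F i).
Proof. by have [Fs _ _] := FP; have [k []] := Fs i I. Qed.

Lemma facet_nonempty i : F i !=set0.
Proof.
have [Fs _ _] := FP; have [k [_ _ [x0 [B [Fx0 _ _ _]]]]] := Fs i I.
by exists x0.
Qed.

Hypothesis Psimple : simple_polytope n P.
(* The edges of [P] at [w], when [w] is a vertex. *)
Hypothesis drop_facet : forall w i0, P w -> F i0 w ->
  exists y, P y /\ facets_of y = (facets_of w :\ i0)%SET.

(* The functionals [a i] of the facets at a vertex [w] form with the edge
   directions [u j] a diagonal matrix with negative entries; hence the [u j] span
   the cone of [P] at [w], and a functional not minimal at [w] decreases along one
   of them. *)
Lemma descending_edge w v l : P w -> #|facets_of w| = n -> P v ->
  lform v l < lform w l ->
  exists i0 y, [/\ F i0 w, P y, facets_of y = (facets_of w :\ i0)%SET &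
    lform y l < lform w l].
Proof.
move=> Pw wn Pv vw; case: Psimple => _ [x0 [B [_ Bfree _ PB]]] _.
pose e (j : 'I_n) : 'I_d := enum_val (cast_ord (esym wn) j).
have eF j : F (e j) w by apply/facets_ofP; exact: enum_valP.
have e_inj : injective e by move=> i j /enum_val_inj /cast_ord_inj.
have /choice [y yP] : forall j, exists y, P y /\ facets_of y = (facets_of w :\ e j)%SET.
  by move=> j; exact: drop_facet.
have /choice [a aP] : forall i, exists a, forall x, P x ->
    lform x a <= lform w a /\ (F (e i) x <-> lform x a = lform w a).
  move=> i; have [a [b [Pab FE]]] := facet_face (e i).
  have wb : lform w a = b by have := eF i; rewrite FE => -[].
  exists a => x Px; rewrite wb; split; first exact: Pab.
  by rewrite FE; split=> [[]|].
pose U := \matrix_(j < n) (y j - w).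
pose A := \matrix_(k < N, i < n) a i k 0.
have rowA x i : (x *m A) 0 i = lform x (a i).
  by rewrite lformE mxE; apply: eq_bigr => k _; rewrite mxE.
have UA i j : (U *m A) j i = lform (y j) (a i) - lform w (a i).
  by rewrite -lformB lformE mxE; apply: eq_bigr => k _; rewrite !mxE.
pose dd := \row_j (lform (y j) (a j) - lform w (a j)).
have dneg j : dd 0 j < 0.
  rewrite mxE subr_lt0 lt_neqAle; have [-> iff] := aP j _ (yP j).1.
  rewrite andbT; apply/negP => /eqP /iff /facets_ofP.
  by rewrite (yP j).2 !inE eqxx.
have UAE : U *m A = diag_mx dd.
  apply/matrixP => j i; rewrite UA !mxE; have [->|ji] := eqVneq j i.
    by rewrite mulr1n.
  rewrite mulr0n; apply/eqP; rewrite subr_eq0; apply/eqP.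
  apply/(aP i _ (yP j).1).2/facets_ofP.
  rewrite (yP j).2 !inE (inj_eq e_inj) eq_sym ji; apply/asboolP; exact: eF.
have Ufree : row_free U.
  have : \det (diag_mx dd) != 0.
    by rewrite det_diag; apply/prodf_neq0 => j _; rewrite lt_eqF.
  rewrite -unitfE => dU.
  have : (n <= \rank (U *m A))%N by rewrite UAE mxrank_unit // unitmxE.
  by rewrite /row_free eqn_leq rank_leq_row => /leq_trans; apply; exact: mxrankM_maxl.
have PwB x : P x -> (x - w <= B)%MS.
  move=> Px; rewrite (_ : x - w = (x - x0) - (w - x0)); last first.
    by rewrite opprB addrA subrK.
  by rewrite addmx_sub ?eqmx_opp ?PB.
have UB : (U <= B)%MS by apply/row_subP => j; rewrite rowK; apply: PwB; exact: (yP j).1.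
(* [U] has [n] free rows inside the row space of [B], which also has rank [n], so the two row spaces
   coincide. *)
have : (v - w <= U)%MS.
  apply: submx_trans (PwB v Pv) _.
  have := mxrank_leqif_sup UB; move=> [_ <-].
  by move: Ufree Bfree; rewrite /row_free => /eqP -> /eqP ->.
move=> /submxP [c cE].
have c0 j : 0 <= c 0 j.
  have : lform (v - w) (a j) <= 0 by rewrite lformB subr_le0; case: (aP j v Pv).
  rewrite -rowA cE -mulmxA UAE mul_mx_diag mxE.
  by rewrite nmulr_lle0.
have [j jl] : exists j, lform (y j - w) l < 0.
  apply/not_existsP => h; have : lform (v - w) l < 0 by rewrite lformB subr_lt0.
  rewrite cE mulmx_sum_row lform_sum ltNge => /negP; apply; apply: sumr_ge0 => j _.
  by rewrite lformZ rowK mulr_ge0 // leNgt; apply/negP/h.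
exists (e j), (y j); split; [exact: eF|exact: (yP j).1|exact: (yP j).2|].
by rewrite -subr_lt0 -lformB.
Qed.

(* The facets are ordered by the minimum of a generic functional. *)
Lemma facet_induction : exists v, [/\ P v, #|facets_of v| = n &
  forall good : 'I_d -> Prop, (forall i, F i v -> good i) ->
    (forall w i0, P w -> #|facets_of w| = n -> F i0 w ->
       (forall i, F i w -> i != i0 -> good i) -> good i0) ->
    forall i, good i].
Proof.
have [[k [V PE]] [x0 [B [Px0 _ _ _]]] Pvert] := Psimple.
have [l l_inj] := generic_functional V.
have Pface : face P P.
  exists 0, 0; split=> [x _|]; first by rewrite mulmx0 mxE.
  by apply/seteqP; split=> [x Px|x []//]; split=> //=; rewrite mulmx0 mxE.
have minv A : face P A -> A !=set0 -> exists i, [/\ A (V i),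
    forall x, A x -> lform (V i) l <= lform x l & #|facets_of (V i)| = n].
  move=> /(face_min_vertex PE l_inj) h /h [i [AV Amin Vf]].
  by exists i; split=> //; apply: card_facets_of; exact: Pvert.
have [iv [Pv vmin vn]] := minv P Pface (ex_intro _ x0 Px0).
have PV i : P (V i) by rewrite PE; exact: convex_hull_vertex.
exists (V iv); split=> // good goodv step.
have /choice [m mP] : forall i, exists s, [/\ F i (V s),
    forall x, F i x -> lform (V s) l <= lform x l & #|facets_of (V s)| = n].
  by move=> i; apply: minv; [exact: facet_face|exact: facet_nonempty].
(* The rank for the induction: how many generators of the hull lie below the minimum of the
   functional on [F i]. *)
pose h i := #|[pred s | lform (V s) l < lform (V (m i)) l]|.
suff H e i : (h i < e)%N -> good i by move=> i; exact: (H (h i).+1).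
elim: e i => [//|e IHe] i; rewrite ltnS => hie.
have [Fi Fmin wn] := mP i.
have := vmin _ (PV (m i)); rewrite le_eqVlt => /predU1P[/l_inj vE|vlt].
  by apply: goodv; rewrite vE.
have [i0 [y [Fi0 Py yE ylt]]] := descending_edge (PV _) wn Pv vlt.
(* Every facet at this vertex other than [F i0] contains [y], which is lower, so its minimum is
   lower and its rank smaller. *)
have others i' : F i' (V (m i)) -> i' != i0 -> good i'.
  move=> Fi' ii0; apply: IHe; apply: leq_trans hie.
  have Fy : F i' y.
    by apply/facets_ofP; rewrite yE !inE ii0; exact/asboolP.
  have [_ /(_ y Fy) my _] := mP i'.
  apply: proper_card; apply/fintype.properP; split.
    apply/fintype.subsetP => s; rewrite !inE => /lt_trans; apply.
    exact: le_lt_trans my ylt.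
  by exists (m i'); rewrite !inE ?ltxx // (le_lt_trans my ylt).
(* For [i != i0] the point [y] would lie on [F i] below its minimum; there is no need to exclude
   this, since [others] covers it. *)
have [->|ii0] := eqVneq i i0; last exact: others.
by apply: (step _ _ (PV (m i))) => //.
Qed.

End SimplePolytope.

(** * Isotropy groups of a small cover *)

Section Z2Linear.

Lemma Z2_cases (c : 'Z_2) : c = 0 \/ c = 1.
Proof. by case: c => -[|[|//]] ?; [left|right]; exact: val_inj. Qed.

Lemma Z2_addrr n (g : Z2 n) : g + g = 0.
Proof.
by apply/rowP => i; rewrite !mxE; have [->|->] := Z2_cases (g 0 i); exact: val_inj.
Qed.

Lemma Z2_oppr n (g : Z2 n) : - g = g.
Proof. by apply/eqP; rewrite -subr_eq0 -opprD Z2_addrr oppr0. Qed.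

Lemma Z2_additive_mx k n (f : Z2 k -> Z2 n) : {morph f : x y / x + y} ->
  exists M : 'M['Z_2]_(k, n), forall g, f g = g *m M.
Proof.
move=> fD; have f0 : f 0 = 0 by apply: (addrI (f 0)); rewrite -fD !addr0.
exists (\matrix_i f (delta_mx 0 i)) => g.
rewrite {1}[g]row_sum_delta mulmx_sum_row (big_morph f fD f0).
apply: eq_bigr => i _; rewrite rowK.
by have [->|->] := Z2_cases (g 0 i); rewrite ?scale0r ?scale1r.
Qed.

Lemma Z2_aut_mx n (sigma : {perm Z2 n}) : sigma \in Aut [set: Z2 n]%SET ->
  exists M : 'M['Z_2]_n, [/\ forall g, sigma g = g *m M, injective (fun g : Z2 n => g *m M) &
    forall v, exists g : Z2 n, g *m M = v].
Proof.
move=> sA; have sD : {morph sigma : x y / x + y}.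
  move=> x y; have /morphicP := Aut_morphic sA.
  by move=> /(_ x y); rewrite !inE => /(_ isT isT).
have [M ME] := Z2_additive_mx sD.
exists M; split=> //.
  by move=> x y; rewrite -!ME; exact: perm_inj.
by move=> v; exists ((sigma^-1)%g v); rewrite -ME permKV.
Qed.

Lemma act_add k (X : Type) (to : {action Z2 k &-> X}) x (g h : Z2 k) :
  to x (g + h) = to (to x g) h.
Proof. exact: actTM. Qed.

Lemma act_zero k (X : Type) (to : {action Z2 k &-> X}) x : to x (0 : Z2 k) = x.
Proof. exact: actT1. Qed.

End Z2Linear.

Section OrbitMap.
Variables (R : realType) (n N : nat) (P : set 'rV[R]_N).
Variables (Q : topologicalType) (to : {action Z2 n &-> Q}).

(** From here on the orbit space is seen only through [q], whose fibres are the orbits. Since [P]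
    need not be open in the ambient space, openness of [q] is phrased as reaching all points of [P]
    near [q x]. *)
Lemma orbit_map : continuous_action to -> orbit_space_is to P ->
  exists q : Q -> 'rV[R]_N,
    [/\ continuous q, forall x, P (q x), forall y, P y -> exists x, q x = y,
        forall x x', q x = q x' <-> exists g, x' = to x g &
        (forall x U, nbhs x U ->
           \forall y \near q x, P y -> exists2 x', U x' & q x' = y) /\
        (forall x k, corner_codim R to x k -> facets_at n P (q x) #= `I_k)].
Proof.
move=> toc [h [[k [hk kh hc kc]] hcod]].
pose proj (x : Q) : orbit_space to [set: Z2 n]%G := \pi_(orbit_space to [set: Z2 n]%G) x.
have projc : continuous proj by exact: pi_continuous.
exists (fun x => set_val (h (proj x))); split.
- move=> x; apply: (@continuous_comp _ _ _ (h \o proj)).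
    by apply: continuous_comp; [exact: projc|exact: hc].
  exact: initial_continuous.
- by move=> x; exact: set_valP.
- move=> y Py; have [x xE] : exists x, proj x = k (SigSub (mem_set Py)).
    by exists (repr (k (SigSub (mem_set Py)))); exact: reprK.
  by exists x; rewrite xE kh.
- move=> x x'; split=> [/val_inj /(can_inj hk) /orbit_spaceP [g _ ->]|[g ->]].
    by exists g.
  by congr (set_val (h _)); apply/orbit_spaceP; exists g; rewrite ?inE.
- split=> [x U|x c]; last exact: hcod.
  rewrite nbhsE => -[W [Wo Wx] WU].
  have Vo : open (k @^-1` (proj @` W)).
    apply: open_comp => [y _|]; first exact: kc.
    change (open (proj @^-1` (proj @` W))).
    (* The saturation of an open set is the union of its translates. *)
    have -> : proj @^-1` (proj @` W) = \bigcup_g (to^~ g @^-1` W).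
      apply/seteqP; split=> [x' [w Ww /esym/orbit_spaceP [g _ gE]]|x' [g _ Wg]].
        by exists g => //; rewrite /= -gE.
      by exists (to x' g) => //; apply/orbit_spaceP; exists g^-1%g; rewrite ?inE ?actTK.
    apply: bigcup_open => g _; apply: open_comp Wo => y _; exact: toc.
  case: Vo => B Bo BE.
  have Bx : B (set_val (h (proj x))).
    have : (k @^-1` (proj @` W)) (h (proj x)) by rewrite /= hk; exists x.
    by rewrite -BE.
  apply: filterS (open_nbhs_nbhs (conj Bo Bx)) => y By Py.
  have : (k @^-1` (proj @` W)) (SigSub (mem_set Py)) by rewrite -BE.
  move=> [w Ww wk]; exists w; first exact: WU.
  by rewrite wk kh.
Qed.

End OrbitMap.

Lemma open_homeo_cvg (X Y : topologicalType) (U : set X) (f : X -> Y) x :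
  open U -> {within U, continuous f} -> U x -> f @ x --> f x.
Proof.
move=> Uo /subspace_continuousP fc Ux; have := fc x Ux.
by rewrite within_interior //; exact: (open_nbhs_nbhs (conj Uo Ux)).
Qed.

Section Chart.
Variables (R : realType) (n : nat) (Q : topologicalType) (to : {action Z2 n &-> Q}).

(** With [M] the matrix of the automorphism in a standard chart, [g *m M] marks the coordinates that
    [g] reflects. *)
Definition supported (M : 'M['Z_2]_n) (T : {set 'I_n}) (g : Z2 n) :=
  forall j, (g *m M) 0 j != 0 -> j \in T.

(** A reflection fixes a vector exactly when it only flips vanishing coordinates, so [Z] is the zero
    set of [x] in the chart. Moving the zero coordinates outside [T] slightly away from 0 gives a
    point near [x] with zero set [T], described by the same [M]. *)
Lemma chart_strata x : locally_standard R to -> exists (M : 'M['Z_2]_n) (Z : {set 'I_n}),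
  [/\ injective (fun g : Z2 n => g *m M) /\ (forall v, exists g : Z2 n, g *m M = v),
      forall g, to x g = x <-> supported M Z g, corner_codim R to x #|Z| &
      forall (T : {set 'I_n}) O, T \subset Z -> nbhs x O -> exists x',
        [/\ O x', forall g, to x' g = x' <-> supported M T g &
          corner_codim R to x' #|T|]].
Proof.
move=> [_ /(_ x)] [U [V [phi [psi [chart Ux]]]]].
have [[[Uo Vo] UV VU phic psic] Uinv Vinv [sigma /Z2_aut_mx[M [ME Minj Msurj]] eqv]] := chart.
pose zeros x' : {set 'I_n} := [set j | phi x' 0 j == 0]%SET.
have stab x' : U x' -> forall g, to x' g = x' <-> supported M (zeros x') g.
  move=> Ux' g; split=> [gx j|gM].
    have := eqv x' g Ux'; rewrite gx ME => /rowP /(_ j); rewrite !mxE.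
    case: (Z2_cases ((g *m M) 0 j)); rewrite mxE => -> //= /eqP.
    by rewrite expr1 mulN1r -subr_eq0 opprK -mulr2n mulrn_eq0 inE.
  have [_ <-] := UV _ (Uinv x' g Ux'); have [_ {2}<-] := UV _ Ux'.
  congr psi; rewrite eqv // ME; apply/rowP => j; rewrite !mxE.
  case: (Z2_cases ((g *m M) 0 j)) => gj.
    by move: gj; rewrite mxE => ->; rewrite expr0 mul1r.
  have : j \in zeros x' by apply: gM; rewrite gj.
  by rewrite inE => /eqP ->; rewrite mulr0.
have codim x' : U x' -> corner_codim R to x' #|zeros x'|.
  move=> Ux'; exists U, V, phi, psi; split=> //.
  by rewrite /zeros cardsE; apply: eq_card => j; rewrite inE.
exists M, (zeros x); split; [by []|exact: stab|exact: codim|] => T O TZ xO.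
pose w : 'rV[R]_n := \row_j (j \in zeros x :\: T)%:R.
pose v (e : R) := phi x + e *: w.
have [Vx psix] := UV x Ux.
have v0 : v 0 = phi x by rewrite /v scale0r addr0.
have vc : v @ (0 : R) --> v 0.
  apply: cvgD; first exact: cvg_cst.
  by apply: cvgZr_tmp; exact: cvg_id.
rewrite v0 in vc.
have psivc : psi \o v @ (0 : R) --> psi (phi x).
  by apply: cvg_comp vc _; exact: open_homeo_cvg Vo psic Vx.
rewrite psix in psivc.
have : \forall e \near (0 : R), V (v e) /\ O (psi (v e)).
  have := cvg_near vc (open_nbhs_nbhs (conj Vo Vx)).
  by apply: filterS2 (cvg_near psivc xO) => e.
move=> /nbhs_ballP [e /= e0 eP].
have [Vv Ov] : V (v (e / 2)) /\ O (psi (v (e / 2))).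
  apply: eP; rewrite /ball /= sub0r normrN gtr0_norm ?divr_gt0 //.
  by rewrite ltr_pdivrMr // ltr_pMr // ltr1n.
have [Uv vE] := VU _ Vv.
have zv : zeros (psi (v (e / 2))) = T.
  apply/setP => j; rewrite inE vE !mxE !inE.
  have [jT|jT] /= := boolP (j \in T).
    by rewrite mulr0 addr0; have := fintype.subsetP TZ j jT; rewrite inE.
  have [->|nz] := eqVneq (phi x 0 j) 0; last by rewrite mulr0 addr0 (negPf nz).
  by rewrite add0r mulr1 gt_eqF // divr_gt0.
exists (psi (v (e / 2))); split=> //; rewrite -zv; [exact: stab|exact: codim].
Qed.

End Chart.

Section Characteristic.
Variables (R : realType) (n N d : nat) (P : set 'rV[R]_N).
Variables (F : 'I_d -> set 'rV[R]_N) (Q : topologicalType).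
Variables (to : {action Z2 n &-> Q}) (q : Q -> 'rV[R]_N).
Hypothesis FP : set_bij [set: 'I_d] (facet n P) F.
Hypothesis P_polytope : polytope P.
Hypothesis Q_hausdorff : hausdorff_space Q.
Hypothesis Q_standard : locally_standard R to.
Hypothesis q_cts : continuous q.
Hypothesis qP : forall x, P (q x).
Hypothesis q_onto : forall y, P y -> exists x, q x = y.
Hypothesis q_orbit : forall x x', q x = q x' <-> exists g, x' = to x g.
Hypothesis q_open : forall x U, nbhs x U ->
  \forall y \near q x, P y -> exists2 x', U x' & q x' = y.
Hypothesis q_codim : forall x k, corner_codim R to x k -> facets_at n P (q x) #= `I_k.

Local Notation facets_of := (facets_of F).

Let to_cts : continuous_action to := Q_standard.1.

Lemma delta_support k (i j : 'I_k) : (delta_mx 0 i : Z2 k) 0 j != 0 -> j = i.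
Proof. by rewrite mxE eqxx /=; have [//|_] := eqVneq j i; rewrite eqxx. Qed.

(** The group is abelian, so isotropy is constant along an orbit and becomes a function on [P]; see
    [stabP]. *)
Definition stab (y : 'rV[R]_N) : set (Z2 n) := [set g | forall x, q x = y -> to x g = x].

Lemma toC x (g h : Z2 n) : to (to x g) h = to (to x h) g.
Proof. by rewrite -!actTM; congr (to x _); exact: addrC. Qed.

Lemma stabP x g : stab (q x) g <-> to x g = x.
Proof.
split=> [|xg x' /esym/q_orbit [h ->]]; first exact.
by rewrite toC xg.
Qed.

Lemma near_facets y : P y -> \forall y' \near y, P y' -> (facets_of y' \subset facets_of y)%SET.
Proof.
move=> Py; have Pcl : closed P.
  by apply: compact_closed (polytope_compact P_polytope); exact: norm_hausdorff.
have : \forall y' \near y, forall i, F i y' -> F i y.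
  apply: (@filter_forall _ 'I_d (fun i y' => F i y' -> F i y) (nbhs y) _) => i.
  have [Fy|Fy] := pselect (F i y).
    by apply: filterE => y' _.
  have : open (~` F i) by apply: closed_openC; exact: face_closed (facet_face FP i).
  by move=> Fo; apply: filterS (open_nbhs_nbhs (conj Fo Fy)) => y' nF /nF.
apply: filterS => y' FF Py'; apply/fintype.subsetP => i /facets_ofP /FF.
by move=> ?; exact/facets_ofP.
Qed.

(** An element that moves [x] moves all points near [x], and [q_open] ensures that these meet every
    orbit over points of [P] near [q x]. *)
Lemma near_stab y : P y -> \forall y' \near y, P y' -> stab y' `<=` stab y.
Proof.
move=> /q_onto [x <-].
have : \forall y' \near q x, forall g, P y' -> stab y' g -> stab (q x) g.
  apply: (@filter_forall _ (Z2 n) (fun g y' => P y' -> stab y' g -> stab (q x) g)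
    (nbhs (q x)) _) => g.
  have [xg|xg] := pselect (to x g = x).
    by apply: filterE => y' _ _; exact/stabP.
  have : \forall x' \near x, to x' g <> x'.
    by apply: (@near_neq _ _ (nbhs x) (to^~ g) id (to x g) x) => //; exact: to_cts.
  move=> /q_open; apply: filterS => y' h /h [x' nx' <-] /stabP.
  by move/nx'.
by apply: filterS => y' h Py' g; exact: h.
Qed.

Lemma strata y : P y -> exists (M : 'M['Z_2]_n) (Z : {set 'I_n}),
  [/\ injective (fun g : Z2 n => g *m M) /\ (forall v, exists g : Z2 n, g *m M = v),
      forall g, stab y g <-> supported M Z g, #|facets_of y| = #|Z| &
      forall (T : {set 'I_n}) O, T \subset Z -> nbhs y O -> exists y',
        [/\ O y', P y', forall g, stab y' g <-> supported M T g &
          #|facets_of y'| = #|T|]].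
Proof.
move=> /q_onto [x <-]; have [M [Z [Mbij xZ cod ex]]] := chart_strata x Q_standard.
exists M, Z; split=> //.
- by move=> g; rewrite stabP.
- exact: (card_facets_of FP (q_codim cod)).
- move=> T O TZ /(cvg_near (q_cts (x:=x))) /(ex T _ TZ) [x' [Ox' x'T cod']].
  exists (q x'); split=> //; first by move=> g; rewrite stabP.
  exact: (card_facets_of FP (q_codim cod')).
Qed.

(** Where [F i] is the only facet, the isotropy group has order 2 because its chart support has one
    element. [near_stab] gives inclusions between such groups at nearby points, hence equalities,
    and the stratum is convex. *)
Lemma facet_reflection i : exists lam : Z2 n,
  forall y, P y -> facets_of y = [set i]%SET -> stab y = [set g | g = 0 \/ g = lam].
Proof.
pose A := [set y | P y /\ forall i', F i' y <-> i' = i].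
have AE y : P y -> facets_of y = [set i]%SET -> A y.
  move=> Py yi; split=> // i'; split=> [/facets_ofP|->].
    by rewrite yi inE => /eqP.
  by apply/facets_ofP; rewrite yi inE.
have [[y0 Ay0]|A0] := pselect (A !=set0); last first.
  by exists 0 => y Py yi; case: A0; exists y; exact: AE.
have two y : A y -> exists2 lam, lam != 0 & stab y = [set g | g = 0 \/ g = lam].
  move=> [Py Fy]; have [M [Z [[Minj Msurj] yZ cZ _]]] := strata Py.
  have : #|Z| == 1%N.
    rewrite -cZ (_ : facets_of y = [set i]%SET) ?cards1 //.
    by apply/setP => i'; rewrite [RHS]inE; apply/facets_ofP/eqP => /Fy.
  move=> /cards1P [j Zj]; have [lam lamE] := Msurj (delta_mx 0 j).
  have lamM g : g *m M = delta_mx 0 j -> g = lam by rewrite -lamE => /Minj.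
  exists lam.
    apply/eqP => l0; move: lamE; rewrite l0 mul0mx => /rowP /(_ j).
    by rewrite !mxE !eqxx.
  apply/seteqP; split=> g /=; rewrite yZ Zj.
    move=> gs; have gj j' : j' != j -> (g *m M) 0 j' = 0.
      move=> jj; apply/eqP; apply: contraTT jj => /gs; by rewrite inE negbK.
    have [g0|g1] := Z2_cases ((g *m M) 0 j).
      left; apply: Minj; rewrite mul0mx; apply/rowP => j'; rewrite [RHS]mxE.
      by have [->|/gj] := eqVneq j' j.
    right; apply: lamM; apply/rowP => j'; rewrite [RHS]mxE eqxx.
    by have [->|/gj] := eqVneq j' j.
  move=> [->|->] j'; first by rewrite mul0mx mxE eqxx.
  by rewrite lamE inE => /delta_support ->.
have Ac : convex A.
  by apply: stratum_convex; [exact: polytope_convex|exact: facet_face FP].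
have loc y : A y -> \forall y' \near y, A y' -> stab y' = stab y.
  move=> Ay; apply: filterS (near_stab Ay.1) => y' yy' Ay'.
  have [lam lam0 sy] := two y Ay; have [lam' lam0' sy'] := two y' Ay'.
  have : stab y lam' by apply: yy' => //; [exact: Ay'.1|rewrite sy'; right].
  rewrite {1}sy => -[l0|ll]; first by rewrite l0 eqxx in lam0'.
  by rewrite sy sy' ll.
have [lam _ lamE] := two y0 Ay0; exists lam => y Py /(AE y Py) Ay.
by rewrite -lamE; exact: (convex_locally_constant Ac loc).
Qed.

(* Row [i] of [L] is the generator of the isotropy group over the relative interior
   of the facet [F i]; the second clause expresses that the rows at a given point are
   linearly independent. *)
Lemma characteristic_matrix : exists L : 'M['Z_2]_(d, n),
  [/\ forall y g, P y -> stab y g <->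
        exists2 a : Z2 d, (forall i, a 0 i != 0 -> F i y) & g = a *m L,
      forall y (a : Z2 d), P y -> (forall i, a 0 i != 0 -> F i y) -> a *m L = 0 -> a = 0,
      forall y i0, P y -> F i0 y ->
        exists y', P y' /\ facets_of y' = (facets_of y :\ i0)%SET &
      (forall y g, P y -> #|facets_of y| = n -> stab y g) /\
      (forall y O, P y -> nbhs y O ->
         exists y', [/\ O y', P y' & facets_of y' = finset.set0])].
Proof.
have /choice [lam lamE] := facet_reflection.
pose L := \matrix_i lam i; exists L.
have aL (a : Z2 d) : a *m L = \sum_i a 0 i *: lam i.
  by rewrite mulmx_sum_row; apply: eq_bigr => i _; rewrite rowK.
(* In the chart at [y], the vectors [lam i] of the facets through [y] are the unit vectors indexed
   by [Z], each occurring once. For [j] in [Z], a nearby point with support [[set j]] lies on a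
   single facet, which also contains [y]; the equality of the two cardinals makes this injection of
   [Z] into the facets at [y] bijective. *)
have basis y : P y -> exists (M : 'M['Z_2]_n) (Z : {set 'I_n}),
    [/\ injective (fun g : Z2 n => g *m M), forall g, stab y g <-> supported M Z g,
      forall j, j \in Z -> exists i, F i y /\ lam i *m M = delta_mx 0 j,
      forall i, F i y -> exists2 j, j \in Z & lam i *m M = delta_mx 0 j &
      [/\ forall i i', F i y -> F i' y -> lam i *m M = lam i' *m M -> i = i',
        #|facets_of y| = #|Z| &
        forall (T : {set 'I_n}) O, T \subset Z -> nbhs y O -> exists y',
          [/\ O y', P y', forall g, stab y' g <-> supported M T g &
          #|facets_of y'| = #|T|]]].
  move=> Py; have [M [Z [[Minj Msurj] yZ cZ ex]]] := strata Py.
  have near_facet j : j \in Z -> exists i, i \in facets_of y /\ lam i *m M = delta_mx 0 j.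
    move=> jZ; have jZ' : ([set j] \subset Z)%SET by rewrite finset.sub1set.
    have [y' [y'y Py' y's]] := ex _ _ jZ' (near_facets Py).
    rewrite cards1 => /eqP/cards1P[i y'i]; exists i.
    have {}y'y := y'y Py'; split; first by rewrite (fintype.subsetP y'y) // y'i inE.
    have [g gE] := Msurj (delta_mx 0 j).
    have : stab y' g.
      by apply/y's => j'; rewrite gE inE => /delta_support ->.
    rewrite (lamE i y') //= => -[g0|<- //].
    by move: gE; rewrite g0 mul0mx => /rowP/(_ j); rewrite !mxE !eqxx.
  pose f j := [pick i | (i \in facets_of y) && (lam i *m M == delta_mx 0 j)].
  have fP j : j \in Z -> exists i, [/\ f j = Some i, F i y & lam i *m M = delta_mx 0 j].
    move=> /near_facet [i [iy ij]]; rewrite /f; case: pickP => [i' /andP[/facets_ofP]|/(_ i)].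
      by move=> Fi' /eqP i'j; exists i'.
    by rewrite iy ij eqxx.
  have delta_inj (j j' : 'I_n) : delta_mx 0 j = delta_mx 0 j' :> Z2 n -> j = j'.
    by move=> e; apply: (@delta_support _ j' j); rewrite -e mxE !eqxx.
  have f_inj : {in Z &, injective f}.
    move=> j j' /fP[i [-> _ ij]] /fP[i' [-> _ ij']] [ii'].
    by apply: delta_inj; rewrite -ij -ij' ii'.
  have fZ : f @: Z = Some @: facets_of y.
    apply/eqP; rewrite eqEcard !card_in_imset // ?cZ ?leqnn ?andbT; last first.
      by move=> i i' _ _ [].
    apply/fintype.subsetP => _ /imsetP [j /fP [i [-> Fi _]] ->].
    by apply: imset_f; exact/facets_ofP.
  have yf i : F i y -> exists j, [/\ j \in Z, f j = Some i & lam i *m M = delta_mx 0 j].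
    move=> /facets_ofP iy; have : Some i \in f @: Z by rewrite fZ imset_f.
    move=> /imsetP [j jZ jE]; exists j; split=> //.
    by have [i' []] := fP j jZ; rewrite -jE => -[->].
  exists M, Z; split=> //.
  - by move=> j /fP [i [_ Fi ij]]; exists i.
  - by move=> i /yf [j [jZ _ ij]]; exists j.
  - split=> // i i' /yf [j [_ ji ->]] /yf [j' [_ ji' ->]] /delta_inj jj.
    by move: ji; rewrite jj ji' => -[].
have sub y (a : Z2 d) : P y -> (forall i, a 0 i != 0 -> F i y) -> stab y (a *m L).
  move=> Py ay; have [M [Z [_ yZ _ yb _]]] := basis y Py.
  apply/yZ => j; apply: contraR => jZ; rewrite aL mulmx_suml summxE big1 // => i _.
  rewrite -scalemxAl mxE.
  have [->|/ay/yb [j' j'Z ->]] := eqVneq (a 0 i) 0; first by rewrite mul0r.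
  rewrite [X in _ * X](_ : _ = 0) ?mulr0 //; apply/eqP.
  by apply: contraR jZ => /delta_support ->.
have span y g : P y -> stab y g ->
    exists2 a : Z2 d, (forall i, a 0 i != 0 -> F i y) & g = a *m L.
  move=> Py; have [M [Z [Minj yZ yb _ _]]] := basis y Py => /yZ gZ.
  suff [a ay aM] : exists2 a : Z2 d, (forall i, a 0 i != 0 -> F i y) & g *m M = a *m L *m M.
    by exists a => //; exact: Minj.
  rewrite [g *m M]row_sum_delta.
  apply: (big_ind (fun v => exists2 a : Z2 d,
    (forall i, a 0 i != 0 -> F i y) & v = a *m L *m M)).
  - by exists 0; [move=> i; rewrite mxE eqxx|rewrite !mul0mx].
  - move=> _ _ [a ay ->] [b by_ ->]; exists (a + b); last by rewrite !mulmxDl.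
    move=> i; rewrite mxE; have [->|/ay //] := eqVneq (a 0 i) 0.
    by rewrite add0r; exact: by_.
  - move=> j _; have [->|/gZ/yb [i [Fi ij]]] := eqVneq ((g *m M) 0 j) 0.
      by exists 0; [move=> i; rewrite mxE eqxx|rewrite !mul0mx scale0r].
    exists ((g *m M) 0 j *: delta_mx 0 i); last first.
      by rewrite -!scalemxAl -rowE rowK ij.
    move=> i'; have [->//|ii'] := eqVneq i' i.
    by rewrite !mxE eqxx (negPf ii') mulr0 eqxx.
have indep y (a : Z2 d) : P y -> (forall i, a 0 i != 0 -> F i y) -> a *m L = 0 -> a = 0.
  move=> Py ay a0; have [M [Z [Minj yZ _ yb [uniq _ _]]]] := basis y Py.
  apply/rowP => i; rewrite [RHS]mxE; apply/eqP/negPn/negP => ai.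
  have [j jZ ij] := yb i (ay i ai).
  have : (a *m L *m M) 0 j = 0 by rewrite a0 mul0mx mxE.
  rewrite aL mulmx_suml summxE (bigD1 i) //= big1 => [|i' ii'].
    by rewrite addr0 -scalemxAl ij !mxE !eqxx mulr1 => /eqP; rewrite (negPf ai).
  rewrite -scalemxAl mxE; have [->|ai'] := eqVneq (a 0 i') 0; first by rewrite mul0r.
  have [j' _ ij'] := yb i' (ay i' ai').
  rewrite ij' [X in _ * X](_ : _ = 0) ?mulr0 //; apply/eqP.
  apply: contraR ii' => /delta_support jj.
  by apply/eqP; apply: uniq; [exact: ay|exact: ay|rewrite ij ij' jj].
have lamL i : lam i = delta_mx 0 i *m L by rewrite -rowE rowK.
have stab_lam y i : P y -> F i y -> stab y (lam i).
  by move=> Py Fi; rewrite lamL; apply: sub => // i' /delta_support ->.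
split=> //.
- by move=> y g Py; split=> [|[a ay ->]]; [exact: span|exact: sub].
- move=> y i0 Py Fi0; have [M [Z [Minj yZ yb by_ [uniq _ ex]]]] := basis y Py.
  have [j0 j0Z ij0] := by_ i0 Fi0.
  (* The point [y'] near [y] has isotropy spanned by the unit vectors other than [j0], so it leaves
     [F i0]. For any other facet [F i] at [y], [lam i] fixes the orbit over [y'] and is a
     combination of the generators there; independence at [y] forces that combination to be [lam i]
     itself, so [y'] stays on [F i]. *)
  have TZ : ((Z :\ j0) \subset Z)%SET by exact: subD1set.
  have [y' [/(_ _)y'y Py' y's _]] := ex _ _ TZ (near_facets Py).
  have {}y'y := y'y Py'.
  exists y'; split=> //; apply/setP => i; rewrite in_setD1.
  apply/idP/andP => [iy'|[ii0 /facets_ofP Fi]].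
    split; last exact: fintype.subsetP y'y i iy'.
    apply/eqP => ii0; move: iy'; rewrite ii0 => /facets_ofP /(stab_lam _ _ Py').
    by move=> /y's /(_ j0); rewrite ij0 mxE !eqxx !inE eqxx => /(_ isT).
  have [j jZ ij] := by_ i Fi.
  have : stab y' (lam i).
    apply/y's => j'; rewrite ij => /delta_support ->; rewrite !inE jZ andbT.
    apply: contra ii0 => /eqP jj0; apply/eqP; apply: uniq => //.
    by rewrite ij ij0 jj0.
  move=> /(span _ _ Py') [a ay' aE].
  have : a - delta_mx 0 i = 0.
    apply: (indep y) => //.
      move=> i'; rewrite !mxE eqxx /=; have [->//|ii'] := eqVneq i' i.
      rewrite subr0 => /ay' /facets_ofP Fi'.
      by have /facets_ofP := fintype.subsetP y'y _ Fi'.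
    by rewrite mulmxBl -aE lamL subrr.
  move=> /eqP; rewrite subr_eq0 => /eqP ai.
  by apply/facets_ofP/ay'; rewrite ai mxE !eqxx.
- split=> [y g Py yn|y O Py yO].
    have [M [Z [_ yZ _ _ [_ cZ _]]]] := basis y Py.
    apply/yZ => j _; suff -> : Z = finset.setT by rewrite inE.
    by apply/eqP; rewrite eqEcard finset.subsetT cardsT card_ord -cZ yn leqnn.
  have [M [Z [_ _ _ _ [_ _ ex]]]] := basis y Py.
  have [y' [Oy' Py' _ y'0]] := ex _ _ (finset.sub0set Z) yO.
  by exists y'; split=> //; apply/eqP; rewrite -cards_eq0 y'0 cards0.
Qed.

End Characteristic.

(** * Sections and lifts *)

Section Within.
Variables (X Y : topologicalType).

Lemma cvg_within_near (f f' : X -> Y) (A : set X) x : A x ->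
  (\forall y \near x, A y -> f y = f' y) ->
  f @ within A (nbhs x) --> f x -> f' @ within A (nbhs x) --> f' x.
Proof.
move=> Ax ff' fc O; rewrite -(nbhs_singleton ff' Ax) => fO.
have H : \forall y \near x, A y -> O (f y) := cvg_near fc fO.
by apply: filterS2 ff' H => y h + Ay; rewrite h // => /(_ Ay).
Qed.

Lemma cvg_withinS (f : X -> Y) (A B : set X) (x : X) (l : Y) : A `<=` B ->
  f @ within B (nbhs x) --> l -> f @ within A (nbhs x) --> l.
Proof.
move=> AB fc O lO; have H : \forall y \near x, B y -> O (f y) := cvg_near fc lO.
by apply: filterS H => y + /AB.
Qed.

End Within.

Lemma abs_continuous (R : realType) n :
  continuous (fun v : 'rV[R]_n => \row_j `|v 0 j|).
Proof.
move=> v O /nbhs_ballP [e /= e0 eO]; apply/nbhs_ballP; exists e => // w [_ vw].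
apply: eO; split=> // i j; rewrite !mxE.
apply: le_lt_trans (vw 0 j); exact: ler_dist_dist.
Qed.

Lemma sign_absE (R : realType) (a : R) : (-1) ^+ ((a < 0)%R%:R : 'Z_2) * a = `|a|.
Proof.
case: ltP => a0; last by rewrite ger0_norm //; exact: mul1r.
by rewrite ltr0_norm //; exact: mulN1r.
Qed.

Section OrbitSection.
Variables (R : realType) (n N d : nat) (P : set 'rV[R]_N).
Variables (F : 'I_d -> set 'rV[R]_N) (Q : topologicalType).
Variables (to : {action Z2 n &-> Q}) (q : Q -> 'rV[R]_N).
Hypothesis FP : set_bij [set: 'I_d] (facet n P) F.
Hypothesis P_polytope : polytope P.
Hypothesis P_nonempty : P !=set0.
Hypothesis Q_hausdorff : hausdorff_space Q.
Hypothesis Q_standard : locally_standard R to.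
Hypothesis q_cts : continuous q.
Hypothesis qP : forall x, P (q x).
Hypothesis q_onto : forall y, P y -> exists x, q x = y.
Hypothesis q_orbit : forall x x', q x = q x' <-> exists g, x' = to x g.
Hypothesis q_open : forall x U, nbhs x U ->
  \forall y \near q x, P y -> exists2 x', U x' & q x' = y.
Hypothesis q_free : forall x g, facets_of F (q x) = finset.set0 -> to x g = x -> g = 1%g.
Hypothesis interior_dense : forall y O, P y -> nbhs y O ->
  exists y', [/\ O y', P y' & facets_of F y' = finset.set0].

Let S (f : 'rV[R]_N -> Q) y := q (f y) = y /\ f @ within P (nbhs y) --> f y.

(* In a standard chart every orbit has a unique point with nonnegative
   coordinates. *)
Let local_section y : P y -> exists f, \forall y' \near y, P y' -> S f y'.
Proof.
move=> Py; have [x xy] := q_onto Py.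
have [_ /(_ x)] := Q_standard; move=> [U [V [phi [psi [chart Ux]]]]].
have [[[Uo Vo] UV VU phic psic] Uinv Vinv [sigma sA eqv]] := chart.
have [M [ME Minj Msurj]] := Z2_aut_mx sA.
pose absv (v : 'rV[R]_n) : 'rV[R]_n := \row_j `|v 0 j|.
pose r x' := psi (absv (phi x')).
have rE x' : U x' -> exists g, r x' = to x' g.
  move=> Ux'; have [g gE] := Msurj (\row_j (phi x' 0 j < 0)%R%:R).
  exists g; have [_ <-] := UV _ (Uinv _ g Ux'); congr psi.
  by rewrite eqv // ME gE; apply/rowP => j; rewrite !mxE sign_absE.
have r_inv x' g : U x' -> r (to x' g) = r x'.
  move=> Ux'; congr psi; rewrite eqv //; apply/rowP => j; rewrite !mxE.
  by rewrite normrM normrX normrN1 expr1n mul1r.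
have r_cts x' : U x' -> r @ x' --> r x'.
  move=> Ux'; apply: (@cvg_comp _ _ _ phi (psi \o absv) _ (nbhs (phi x'))).
    exact: open_homeo_cvg Uo phic Ux'.
  apply: (@cvg_comp _ _ _ absv psi _ (nbhs (absv (phi x')))).
    exact: abs_continuous.
  apply: open_homeo_cvg Vo psic _; have [g] := rE x' Ux'.
  have [g' gE] := Msurj (\row_j (phi x' 0 j < 0)%R%:R) => _.
  have <- : reflect_coords (sigma g') (phi x') = absv (phi x').
    by rewrite ME gE; apply/rowP => j; rewrite !mxE sign_absE.
  by apply: Vinv; have [] := UV x' Ux'.
have /choice [f fE] : forall y', exists z, forall x', U x' -> q x' = y' -> z = r x'.
  move=> y'; have [[x' [Ux' xy']]|h] := pselect (exists x', U x' /\ q x' = y').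
    exists (r x') => x'' Ux''; rewrite -xy' => /esym/q_orbit [g ->].
    by rewrite r_inv.
  by exists x => x' Ux' xy'; case: h; exists x'.
exists f; rewrite -xy.
apply: filterS (q_open (open_nbhs_nbhs (conj Uo Ux))) => y' h /h [x' Ux' <-] {h}.
have fx' : f (q x') = r x' by exact: fE.
split; rewrite fx'.
  by have [g ->] := rE x' Ux'; symmetry; apply/q_orbit; exists g.
move=> O /(cvg_near (r_cts x' Ux')) rO.
have UrO : nbhs x' (U `&` [set z | O (r z)]).
  by apply: filterI rO; exact: (open_nbhs_nbhs (conj Uo Ux')).
by apply: filterS (q_open UrO) => y'' h /h [x'' [Ux'' rx''] <-] /=; rewrite (fE _ x'').
Qed.

(** Two sections over [D] are compared on its points off all facets, where isotropy is trivial. If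
    the resulting element failed at some [y], it would fail on a neighbourhood of [y] in [P], which
    contains such points by [interior_dense]. *)
Lemma orbit_section : exists s : 'rV[R]_N -> Q, forall y, P y ->
  q (s y) = y /\ s @ within P (nbhs y) --> s y.
Proof.
have Pc := polytope_convex P_polytope.
have to_cts := Q_standard.1.
apply: (@glue_sections R N P Q (Z2 n) to S) => //; last exact: polytope_compact.
- move=> f f' y Py ff' [fy fc]; split; last exact: cvg_within_near fc.
  by rewrite -(nbhs_singleton ff' Py).
- move=> f y g Py [fy fc]; split; first by rewrite -[RHS]fy; symmetry; apply/q_orbit; exists g.
  by apply: (cvg_comp _ (fun z => to z g) fc); exact: to_cts.
- move=> D f1 f2 Dc Do fS.
  pose A := D `&` [set y | P y /\ forall i, F i y <-> False].
  have AP : A `<=` P by move=> y [_ []].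
  have Ac : convex A.
    by apply: convexI => //; apply: stratum_convex => //; exact: facet_face FP.
  have A0 y : A y -> facets_of F y = finset.set0.
    move=> [_ [_ Fy]]; apply/setP => i; rewrite finset.in_set0.
    by apply/negP => /facets_ofP /Fy.
  have [|y Ay|y Ay|y [Dy [Py _]]|y g Ay|g gE] :=
      @free_orbit_unique R N Q _ to A f1 f2 Q_hausdorff _ Ac.
  + exact: to_cts.
  + have [[_ fc] _] := fS y Ay.1 (AP _ Ay); exact: cvg_withinS AP fc.
  + have [_ [_ fc]] := fS y Ay.1 (AP _ Ay); exact: cvg_withinS AP fc.
  + have [[e1 _] [e2 _]] := fS y Dy Py.
    by apply/q_orbit; rewrite e1 e2.
  + have [_ [e2 _]] := fS y Ay.1 (AP _ Ay).
    by apply: q_free; rewrite e2; exact: A0.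
  exists g => y Dy Py; apply: contrapT => ne.
  have [[_ c1] [_ c2]] := fS y Dy Py.
  have : \forall y' \near within P (nbhs y), f1 y' <> to (f2 y') g.
    apply: (@near_neq _ _ (within P (nbhs y)) f1 (fun y => to (f2 y) g) _
      (to (f2 y) g) _ _ c1) => //.
    by apply: (cvg_comp _ (fun z => to z g) c2); exact: to_cts.
  move=> H; have {}H : \forall y' \near y, P y' -> f1 y' <> to (f2 y') g by [].
  have := interior_dense Py (filterI (open_nbhs_nbhs (conj Do Dy)) H).
  move=> [y' [[Dy' ne'] Py' Fy']]; apply: (ne' Py'); apply: gE; split=> //; split=> // i.
  by split=> // /facets_ofP; rewrite Fy' finset.in_set0.
Qed.

End OrbitSection.

Section Bundle.
Variables (m : nat) (Q M : topologicalType) (to : {action Z2 m &-> M}) (p : M -> Q).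
Hypothesis pb : principal_bundle to p.

Lemma bundle_proj x g : p (to x g) = p x.
Proof.
by have [_ _ /(_ (p x)) [U [t [s [_ Ux _ /(_ x g Ux) []]]]]] := pb.
Qed.

Lemma bundle_free x g : to x g = x -> g = 1%g.
Proof.
have [_ _ /(_ (p x)) [U [t [s [_ Ux _ /(_ x g Ux) [_ te]]]]]] := pb.
by move=> xg; move: te; rewrite xg -[X in X = _]addr0 => /addrI /esym.
Qed.

Lemma bundle_act_inj x a b : to x a = to x b -> a = b.
Proof.
move=> ab; apply/eqP; rewrite -subr_eq0; apply/eqP; apply: (bundle_free (x := x)).
by rewrite act_add ab Z2_oppr -act_add Z2_addrr act_zero.
Qed.

Lemma bundle_transitive x x' : p x = p x' -> exists g, x' = to x g.
Proof.
move=> xx'; have [_ _ /(_ (p x)) [U [t [s [_ Ux [_ tr _ _ _] eqv]]]]] := pb.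
exists (t x' - t x).
have Ux' : (p @^-1` U) x' by rewrite /= -xx'.
have [px tx] := eqv x (t x' - t x) Ux.
have Uxg : (p @^-1` U) (to x (t x' - t x)) by rewrite /= px.
apply: etrans (esym (tr _ Ux').2) _; apply: etrans _ (tr _ Uxg).2.
by rewrite px -xx' tx addrC subrK.
Qed.

(** Points over distinct base points are separated in [Q]; points of one fibre lie on different
    sheets, which are open because [t] is locally constant. *)
Lemma bundle_hausdorff : hausdorff_space Q -> hausdorff_space M.
Proof.
rewrite !open_hausdorff => Qh x x' xx'; have [_ pc loc] := pb.
have [pxx'|/Qh [[A B] /= []]] := eqVneq (p x) (p x'); last first.
  rewrite !inE => Ax Bx' [Ao Bo AB].
  exists (p @^-1` A, p @^-1` B); rewrite /= ?inE; split=> //.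
  - by apply: open_comp Ao => y _; exact: pc.
  - by apply: open_comp Bo => y _; exact: pc.
  - apply/seteqP; split=> // y [Ay By].
    by have : set0 (p y) by rewrite -AB.
have [U [t [s [Uo Ux [[pUo _] tr _ tc _] _]]]] := loc (p x).
have Ux' : U (p x') by rewrite -pxx'.
have tne : t x != t x'.
  apply: contra xx' => /eqP tt; apply/eqP.
  have [_ <-] := tr x Ux; have [_ <-] := tr x' Ux'.
  by rewrite tt pxx'.
have lc y : U (p y) -> nbhs y [set z | U (p z) /\ t z = t y].
  move=> Uy; have := open_homeo_cvg pUo tc Uy => c.
  have Oy : nbhs (p y, t y : discrete_topology (Z2 m)) (U `*` [set t y]).
    exists (U, [set t y]) => //; split=> //=; exact: (open_nbhs_nbhs (conj Uo Uy)).
  by apply: filterS (cvg_near c Oy) => z [].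
have cl y : U (p y) -> open [set z | U (p z) /\ t z = t y].
  move=> Uy; rewrite openE => z [Uz tz]; rewrite /interior -tz; exact: lc.
exists ([set z | U (p z) /\ t z = t x], [set z | U (p z) /\ t z = t x']).
  by rewrite /= !inE.
split; [exact: cl|exact: cl|].
apply/eqP/seteqP; split=> // z [[_ tz] [_ tz']]; move/eqP: tne; apply.
by rewrite -tz.
Qed.

Lemma bundle_section z : exists (U : set Q) (s : Q -> M), [/\ open U, U z &
  forall z', U z' -> p (s z') = z' /\ s @ z' --> s z'].
Proof.
have [_ _ /(_ z) [U [t [s [Uo Uz [[_ Vo] _ st _ sc] _]]]]] := pb.
exists U, (fun z' => s (z', 0 : discrete_topology (Z2 m))); split=> // z' Uz'.
have Vz : (U `*` [set: discrete_topology (Z2 m)]) (z', 0 : discrete_topology (Z2 m)) by [].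
split; first by have [_ []] := st _ Vz.
apply: (@cvg_comp _ _ _ (fun z' => (z', 0 : discrete_topology (Z2 m))) s _
  (nbhs (z', 0 : discrete_topology (Z2 m)))).
  move=> O [[A B] [/= zA zB] ABO]; apply: filterS zA => w Aw; apply: ABO.
  by split=> //=; exact: nbhs_singleton zB.
exact: open_homeo_cvg Vo sc Vz.
Qed.

Section Lift.
Variables (R : realType) (N : nat) (P : set 'rV[R]_N) (f : 'rV[R]_N -> Q).
Hypothesis Q_hausdorff : hausdorff_space Q.
Hypothesis P_convex : convex P.
Hypothesis P_compact : compact P.
Hypothesis f_cts : forall y, P y -> f @ within P (nbhs y) --> f y.

(** Local sections of the bundle composed with [f] are glued. The lift is unique up to a
    translation, and a translation adjusts its value at [v] to [z]. *)
Lemma bundle_lift v z : P v -> p z = f v -> exists s : 'rV[R]_N -> M,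
  s v = z /\ forall y, P y -> p (s y) = f y /\ s @ within P (nbhs y) --> s y.
Proof.
move=> Pv zv; have [to_cts _ _] := pb.
pose S (s : 'rV[R]_N -> M) y := p (s y) = f y /\ s @ within P (nbhs y) --> s y.
suff [s sS] : exists s, forall y, P y -> S s y.
  have [g gE] : exists g, z = to (s v) g.
    by apply: bundle_transitive; rewrite zv (sS v Pv).1.
  exists (fun y => to (s y) g); split=> // y /sS [ps sc].
  split; first by rewrite bundle_proj.
  by apply: (cvg_comp _ (fun z => to z g) sc); exact: to_cts.
apply: (@glue_sections R N P M (Z2 m) to S) => //; last 2 first.
- by exists v.
- move=> y Py; have [U [s [Uo Uy sU]]] := bundle_section (f y).
  exists (s \o f).
  have : \forall y' \near y, P y' -> U (f y').
    exact: (cvg_near (f_cts Py) (open_nbhs_nbhs (conj Uo Uy))).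
  apply: filterS => y' h /[dup] Py' /h Uy'; have [ps sc] := sU _ Uy'.
  by split=> //; apply: cvg_comp (f_cts Py') sc.
- move=> s s' y Py ss' [ps sc]; split; last exact: cvg_within_near sc.
  by rewrite -(nbhs_singleton ss' Py).
- move=> s y g Py [ps sc]; split; first by rewrite bundle_proj.
  by apply: (cvg_comp _ (fun z => to z g) sc); exact: to_cts.
- move=> D f1 f2 Dc Do fS.
  have DP : D `&` P `<=` P by move=> y [].
  have [||y Ay|y Ay|y [Dy Py]|y g [Dy Py]|g gE] :=
      @free_orbit_unique R N M _ to (D `&` P) f1 f2 (bundle_hausdorff Q_hausdorff).
  + exact: to_cts.
  + exact: convexI.
  + have [[_ fc] _] := fS y Ay.1 Ay.2; exact: cvg_withinS DP fc.
  + have [_ [_ fc]] := fS y Ay.1 Ay.2; exact: cvg_withinS DP fc.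
  + have [[e1 _] [e2 _]] := fS y Dy Py.
    by apply: bundle_transitive; rewrite e1 e2.
  + exact: bundle_free.
  by exists g => y Dy Py; exact: gE.
Qed.

End Lift.

End Bundle.

Section BundleTransport.
Variables (m : nat) (Q M M' : topologicalType).
Variables (to : {action Z2 m &-> M}) (p : M -> Q).
Variables (to' : {action Z2 m &-> M'}) (p' : M' -> Q) (f : M -> M').
Hypothesis f_homeo : homeomorphism f.
Hypothesis f_act : forall x g, f (to x g) = to' (f x) g.
Hypothesis f_proj : forall x, p' (f x) = p x.

Lemma principal_bundle_transport : principal_bundle to p -> principal_bundle to' p'.
Proof.
have [k [fk kf fc kc]] := f_homeo; move=> [toc pc loc].
have to'E g : to'^~ g = f \o to^~ g \o k.
  by apply/funext => x /=; rewrite f_act kf.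
have p'E : p' = p \o k by apply/funext => x /=; rewrite -f_proj kf.
have p'c : continuous p' by rewrite p'E => x; apply: continuous_comp; [exact: kc|exact: pc].
split=> //.
  move=> g; rewrite to'E => x; apply: continuous_comp; first exact: kc.
  by apply: continuous_comp; [exact: toc|exact: fc].
move=> z; have [U [t [s [Uo Uz [[pUo Vo] tr st tc sc] eqv]]]] := loc z.
have pk x : p (k x) = p' x by rewrite p'E.
exists U, (t \o k), (f \o s); split=> //; last first.
  move=> x g /=; rewrite -pk => /(eqv (k x) g) [e1 e2].
  by rewrite -[x in to' x]kf -f_act f_proj fk.
split.
- by split=> //; apply: open_comp Uo => x _; exact: p'c.
- move=> x /=; rewrite -pk => Ux; have [? /= e] := tr _ Ux.
  by split=> //; rewrite e kf.
- move=> y Vy; have [Uy /= e] := st y Vy; split; first by rewrite /= f_proj.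
  by rewrite /= f_proj fk.
- apply/subspace_continuousP => x /= Ux.
  have Ukx : U (p (k x)) by rewrite pk.
  apply: (@cvg_withinS _ _ _ _ setT) => //; rewrite withinET.
  rewrite (_ : (fun x => _) = (fun x => (p x, t x : discrete_topology (Z2 m))) \o k).
    apply: (@cvg_comp _ _ _ k _ _ (nbhs (k x))); first exact: kc.
    exact: (open_homeo_cvg pUo tc Ukx).
  by apply/funext => y /=; rewrite pk.
- apply/subspace_continuousP => y Vy.
  apply: (@cvg_withinS _ _ _ _ setT) => //; rewrite withinET.
  apply: (@cvg_comp _ _ _ s f _ (nbhs (s y))); last exact: fc.
  exact: open_homeo_cvg Vo sc Vy.
Qed.

End BundleTransport.

(** * The developing map from the lifts of the section *)

Section Developing.
Variables (R : realType) (n N d m : nat) (P : set 'rV[R]_N).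
Variables (F : 'I_d -> set 'rV[R]_N) (Q M : topologicalType).
Variables (toQ : {action Z2 n &-> Q}) (toM : {action Z2 m &-> M}) (p : M -> Q).
Hypothesis P_simple : simple_polytope n P.
Hypothesis FP : set_bij [set: 'I_d] (facet n P) F.
Hypothesis Q_cover : small_cover toQ P.
Hypothesis pb : principal_bundle toM p.
Hypothesis M_connected : connected [set: M].

(* The lift [sig g] of the section [s] translated by [g] jumps by [c g i] across the
   facet [F i]. The lifts agree at a vertex, and the induction on the facets shows
   that [c g i] does not depend on [g]. *)
Lemma lifts_jump (q : Q -> 'rV[R]_N) (s : 'rV[R]_N -> Q) (L : 'M['Z_2]_(d, n)) :
  (forall y, P y -> q (s y) = y /\ s @ within P (nbhs y) --> s y) ->
  (forall y g, P y -> toQ (s y) g = s y <->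
    exists2 a : Z2 d, (forall i, a 0 i != 0 -> F i y) & g = a *m L) ->
  (forall y i0, P y -> F i0 y ->
     exists y', P y' /\ facets_of F y' = (facets_of F y :\ i0)%SET) ->
  (forall y g, P y -> #|facets_of F y| = n -> toQ (s y) g = s y) ->
  exists (sig : Z2 n -> 'rV[R]_N -> M) (C : 'M['Z_2]_(d, m)),
    (forall g y, P y -> p (sig g y) = toQ (s y) g /\
       sig g @ within P (nbhs y) --> sig g y) /\
    (forall g y i, F i y -> sig (g + row i L) y = toM (sig g y) (row i C)).
Proof.
move=> sP sstab drop svert.
have Ppoly : polytope P by case: P_simple.
have Pc := polytope_convex Ppoly.
have Qh : hausdorff_space Q by case: Q_cover => -[].
have toQc : continuous_action toQ by case: Q_cover => _ [].
have FsubP i y : F i y -> P y by exact: face_sub (facet_face FP i) y.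
have [v [Pv vn good_ind]] := facet_induction FP P_simple drop.
have [U [s0 [_ Uv s0U]]] := bundle_section pb (s v).
have pz : p (s0 (s v)) = s v := (s0U _ Uv).1.
(* At the vertex [v] the isotropy group is the whole group, so all translates of [s] agree there and
   every lift may start at the same point over [s v]. *)
have /choice [sig sigP] : forall g : Z2 n, exists sg : 'rV[R]_N -> M,
    sg v = s0 (s v) /\ forall y, P y -> p (sg y) = toQ (s y) g /\
       sg @ within P (nbhs y) --> sg y.
  move=> g; apply: (bundle_lift pb Qh Pc (polytope_compact Ppoly)) => //.
    move=> y Py; have [_ sc] := sP y Py.
    by apply: (cvg_comp _ (fun z => toQ z g) sc); exact: toQc.
  by rewrite pz svert.
pose lam i : Z2 n := row i L.
have lam_stab i y : F i y -> toQ (s y) (lam i) = s y.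
  move=> Fi; apply/sstab; first exact: FsubP Fi.
  by exists (delta_mx 0 i); [move=> j /delta_support ->|rewrite /lam rowE].
have jump (gi : Z2 n * 'I_d) : exists c, forall y, F gi.2 y ->
    sig (gi.1 + lam gi.2) y = toM (sig gi.1 y) c.
  case: gi => g i /=.
  have FP' : F i `<=` P by exact: FsubP.
  apply: (@free_orbit_unique R N M _ toM (F i)) => //.
  - exact: bundle_hausdorff pb Qh.
  - by have [] := pb.
  - exact: face_convex (facet_face FP i).
  - move=> y Fi; have [_ /(_ y (FsubP _ _ Fi)) [_ c]] := sigP (g + lam i).
    exact: cvg_withinS FP' c.
  - move=> y Fi; have [_ /(_ y (FsubP _ _ Fi)) [_ c]] := sigP g.
    exact: cvg_withinS FP' c.
  - move=> y Fi; apply: (bundle_transitive pb).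
    have [_ /(_ y (FsubP _ _ Fi)) [-> _]] := sigP (g + lam i).
    have [_ /(_ y (FsubP _ _ Fi)) [-> _]] := sigP g.
    by rewrite addrC act_add lam_stab.
  - by move=> y h _; exact: (bundle_free pb).
have [c0 c0P] := choice jump; pose c g i := c0 (g, i).
have cP g i y : F i y -> sig (g + lam i) y = toM (sig g y) (c g i).
  exact: (c0P (g, i)).
have free := bundle_act_inj pb.
have c_refl g i : c (g + lam i) i = c g i.
  have [y Fy] := facet_nonempty FP i; apply: (free (sig (g + lam i) y)).
  by rewrite -cP // -addrA Z2_addrr addr0 cP // -act_add Z2_addrr act_zero.
(* The two ways around a point of [F i] and [F j] end on the same lift, and the action on [M] is
   free. *)
have c_comm g i j y : F i y -> F j y ->
    c g i + c (g + lam i) j = c g j + c (g + lam j) i.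
  by move=> Fi Fj; apply: (free (sig g y)); rewrite !act_add -!cP // addrAC.
have c_vertex g i : F i v -> c g i = 0.
  move=> Fi; apply: (free (sig g v)).
  by rewrite -cP // act_zero (sigP (g + lam i)).1 (sigP g).1.
have c_const i g : c g i = c 0 i.
  move: i g; apply: good_ind => [i Fi g|w i0 Pw wn Fi0 others g].
    by rewrite !c_vertex.
  (* In [c_comm] the two values at [i] cancel, since [c _ i] is already known to be constant; for
     [i = i0] this is [c_refl]. *)
  have inv i h : F i w -> c (h + lam i) i0 = c h i0.
    move=> Fi; have [->//|ii0] := eqVneq i i0.
    have := c_comm h i0 i w Fi0 Fi.
    rewrite (others i Fi ii0 (h + _)) (others i Fi ii0 h) addrC => /addrI ->.
    by [].
  (* At a vertex every [g] is isotropy, hence a sum of rows of [L] for facets through [w], so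
     invariance under these rows gives constancy. *)
  have [a aw ->] : exists2 a : Z2 d, (forall i, a 0 i != 0 -> F i w) & g = a *m L.
    by apply/(sstab w g Pw); exact: svert.
  suff H h : c (h + a *m L) i0 = c h i0 by rewrite -[a *m L]add0r H.
  rewrite mulmx_sum_row; move: h.
  apply: (big_ind (fun x => forall h, c (h + x) i0 = c h i0)) => [h|x y Hx Hy h|i _ h].
  - by rewrite addr0.
  - by rewrite addrA Hy Hx.
  - have [->|ai] := Z2_cases (a 0 i); first by rewrite scale0r addr0.
    by rewrite ai scale1r inv //; apply: aw; rewrite ai.
exists sig, (\matrix_i c 0 i); split=> [g y Py|g y i Fi]; first exact: (sigP g).2.
by rewrite rowK -(c_const i g) cP.
Qed.

(** The clauses are those needed for the quotients: [Phi] descends across facets, the kernel of [L]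
    acts on it through [C], and it is transitive on the fibres over [Q]. The last group gives
    freeness of that kernel, surjectivity of [Phi], and surjectivity of [C] on the kernel. *)
Lemma developing_map : exists (q : Q -> 'rV[R]_N) (L : 'M['Z_2]_(d, n))
    (C : 'M['Z_2]_(d, m)) (Phi : 'rV[R]_N -> Z2 d -> M),
  [/\ forall y a, P y -> q (p (Phi y a)) = y /\
        Phi^~ a @ within P (nbhs y) --> Phi y a,
      forall y (a h : Z2 d), P y -> h *m L = 0 -> Phi y (h + a) = toM (Phi y a) (h *m C),
      forall y (a b : Z2 d), P y -> p (Phi y a) = p (Phi y b) ->
        exists2 h : Z2 d, h *m L = 0 & forall i, (a - b - h) 0 i != 0 -> F i y,
      forall y (a b : Z2 d), P y -> (forall i, b 0 i != 0 -> F i y) -> Phi y (a + b) = Phi y a &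
      [/\ forall y (a : Z2 d), P y -> (forall i, a 0 i != 0 -> F i y) -> a *m L = 0 -> a = 0,
        forall x, exists y a, P y /\ Phi y a = x &
        forall t : Z2 m, exists2 h : Z2 d, h *m L = 0 & h *m C = t]].
Proof.
have [Ppoly [x0 [B [Px0 _ _ _]]] _] := P_simple.
have [[_ Qh _ _] Qst Qorb] := Q_cover.
have [q [q_cts qP q_onto q_orbit [q_open q_codim]]] := orbit_map Qst.1 Qorb.
have [L [stabE indep drop [vert dense]]] :=
  characteristic_matrix FP Ppoly Qh Qst q_cts qP q_onto q_orbit q_open q_codim.
have stab0 y g : P y -> facets_of F y = finset.set0 -> stab toQ q y g -> g = 0.
  move=> Py y0 /(stabE y g Py) [a ay ->]; rewrite (_ : a = 0) ?mul0mx //.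
  apply/rowP => i; rewrite mxE; apply/eqP/negPn/negP => /ay /facets_ofP.
  by rewrite y0 finset.in_set0.
have [s sP] : exists s : 'rV[R]_N -> Q, forall y, P y ->
    q (s y) = y /\ s @ within P (nbhs y) --> s y.
  apply: (orbit_section FP Ppoly _ Qh Qst q_onto q_orbit q_open) => //.
    by exists x0.
  by move=> x g x00 xg; apply: (stab0 _ _ (qP x) x00); exact/(stabP q_orbit).
have stab_s y g : P y -> stab toQ q y g <-> toQ (s y) g = s y.
  by move=> Py; have := stabP q_orbit (s y) g; rewrite (sP y Py).1.
have sstab y g : P y -> toQ (s y) g = s y <->
    exists2 a : Z2 d, (forall i, a 0 i != 0 -> F i y) & g = a *m L.
  by move=> Py; rewrite -stab_s // stabE.
have [|sig [C [sigP sig_jump]]] := lifts_jump sP sstab drop.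
  by move=> y g Py yn; apply/stab_s => //; exact: vert.
pose Phi y (a : Z2 d) := toM (sig (a *m L) y) (a *m C).
have pPhi y a : P y -> p (Phi y a) = toQ (s y) (a *m L).
  by move=> Py; rewrite /Phi (bundle_proj pb) (sigP _ y Py).1.
have toMc : continuous_action toM by case: pb.
have Phi_cts y a : P y -> Phi^~ a @ within P (nbhs y) --> Phi y a.
  move=> Py; apply: (cvg_comp _ (fun z => toM z (a *m C)) (sigP (a *m L) y Py).2).
  exact: toMc.
(* Crossing [F i] changes both the lift and the translation by row [i] of [C], and the two changes
   cancel in characteristic 2. *)
have Phi_facet y (a b : Z2 d) : P y -> (forall i, b 0 i != 0 -> F i y) ->
    Phi y (a + b) = Phi y a.
  move=> Py yb; rewrite [b]row_sum_delta; move: a.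
  apply: (big_ind (fun x => forall a, Phi y (a + x) = Phi y a)) => [a|u w Hu Hw a|i _ a].
  - by rewrite addr0.
  - by rewrite addrA Hw Hu.
  - have [->|bi] := Z2_cases (b 0 i); first by rewrite scale0r addr0.
    have Fi : F i y by apply: yb; rewrite bi.
    rewrite bi scale1r /Phi !mulmxDl -!rowE sig_jump // [a *m C + _]addrC act_add.
    by rewrite -[toM (toM _ (row i C)) (row i C)]act_add Z2_addrr act_zero.
have free := bundle_act_inj pb.
have q_toQ y g : P y -> q (toQ (s y) g) = y.
  by move=> Py; rewrite -[RHS](sP y Py).1; symmetry; apply/q_orbit; exists g.
have same_orbit y (g h : Z2 n) : P y -> toQ (s y) g = toQ (s y) h ->
    exists2 b : Z2 d, (forall i, b 0 i != 0 -> F i y) & g - h = b *m L.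
  move=> Py gh; apply/sstab => //.
  by rewrite act_add gh Z2_oppr -act_add Z2_addrr act_zero.
pose K (gt : Z2 n * Z2 m) := (fun y => toM (sig gt.1 y) gt.2) @` P.
have Mh : hausdorff_space M := bundle_hausdorff pb Qh.
have Kc gt : closed (K gt).
  apply: compact_closed => //; apply: continuous_compact; last exact: polytope_compact.
  apply/subspace_continuousP => y Py.
  by apply: (cvg_comp _ (fun z => toM z gt.2) (sigP gt.1 y Py).2); exact: toMc.
have K_all x : exists gt, K gt x.
  have [y [Py [g xg]]] : exists y, P y /\ exists g, p x = toQ (s y) g.
    exists (q (p x)); split; first exact: qP.
    by apply/q_orbit; rewrite (sP _ (qP _)).1.
  have [t xt] : exists t, x = toM (sig g y) t.
    by apply: (bundle_transitive pb); rewrite (sigP g y Py).1.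
  by exists (g, t), y.
pose I := [set gt | exists a : Z2 d, gt = (a *m L, a *m C)].
(* Two pieces can only meet over one [y], where their indices [g] and [a *m L] differ by [b *m L]
   with [b] supported on facets through [y]. Replacing [a] by [a + b] does not change [Phi y a], and
   freeness then determines [t]. *)
have I_sat gt gt' : K gt `&` K gt' !=set0 -> I gt' -> I gt.
  case: gt => g t [x [[y Py /= <-] [y' Py' xE]]] [a gtE].
  move: xE; rewrite gtE /= -/(Phi y' a) => xE.
  have yy : y' = y.
    have := congr1 (q \o p) xE.
    by rewrite /= (bundle_proj pb) pPhi // (sigP g y Py).1 !q_toQ.
  rewrite yy in xE.
  have [b yb gb] :
      exists2 b : Z2 d, (forall i, b 0 i != 0 -> F i y) & g - a *m L = b *m L.
    apply: same_orbit => //.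
    by have := congr1 p xE; rewrite (bundle_proj pb) pPhi // (sigP g y Py).1.
  have gE : g = (a + b) *m L by rewrite mulmxDl -gb addrC subrK.
  exists (a + b); rewrite -gE; congr (_, _).
  apply: (free (sig g y)); rewrite -xE -(Phi_facet y a b Py yb) /Phi.
  by rewrite -gE.
have I_full gt : I gt.
  pose W (A : set (Z2 n * Z2 m)) := \bigcup_(gt in A) K gt.
  have Wc A : closed (W A).
    by apply: closed_bigcup => [|gt' _]; [exact: finite_finset|exact: Kc].
  have WC : W I = ~` W (~` I).
    apply/seteqP; split=> [x [gt1 I1 K1] [gt2 I2 K2]|x nx].
      by apply: I2; apply: I_sat I1; exists x.
    have [gt1 K1] := K_all x; have [I1|I1] := pselect (I gt1); first by exists gt1.
    by case: nx; exists gt1.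
  (* By [I_sat] the pieces indexed by [I] are disjoint from the others, and both unions are finite
     and closed, so [W I] is open and closed. *)
  have WT : W I = setT.
    apply: M_connected.
    - exists (Phi x0 0); exists (0, 0); first by exists 0; rewrite !mul0mx.
      by exists x0; rewrite // /Phi !mul0mx.
    - by exists (W I); rewrite ?setTI // WC; exact: closed_openC.
    - by exists (W I); rewrite ?setTI.
  have : W I (toM (sig gt.1 x0) gt.2) by rewrite WT.
  move=> [gt' I' K']; apply: I_sat I'; exists (toM (sig gt.1 x0) gt.2).
  by split=> //; exists x0.
exists q, L, C, Phi; split=> //.
- by move=> y a Py; split; [rewrite pPhi // q_toQ|exact: Phi_cts].
- by move=> y a h Py h0; rewrite /Phi !mulmxDl h0 add0r addrC act_add.
- move=> y a b Py; rewrite !pPhi // => /(same_orbit _ _ _ Py) [e ye eE].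
  exists (a - b - e); rewrite ?mulmxBl ?eE ?subrr // => i.
  by rewrite opprB addrC subrK; exact: ye.
- split=> // [x|t].
    have [gt [y Py xE]] := K_all x; have [a gtE] := I_full gt.
    by exists y, a; rewrite -xE gtE.
  by have [a [aL aC]] := I_full (0, t); exists a.
Qed.

End Developing.

(** * The real moment-angle manifold *)

Section Compact.

Lemma compact_bij_homeomorphism (X Y : topologicalType) (f : X -> Y) :
  compact [set: X] -> hausdorff_space Y -> continuous f -> injective f ->
  (forall y, exists x, f x = y) -> homeomorphism f.
Proof.
move=> Xk Yh fc fi /choice [g gE].
have gf : cancel f g by move=> x; apply: fi; rewrite gE.
exists g; split=> //; apply/continuous_closedP => A Ac.
have -> : g @^-1` A = f @` A.
  apply/seteqP; split=> [y Ay|_ [x Ax <-]]; last by rewrite /= gf.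
  by exists (g y).
apply: compact_closed => //; apply: continuous_compact; first exact: continuous_subspaceT.
exact: subclosed_compact Ac Xk _.
Qed.

Lemma quot_compact (T : topologicalType) (E : T -> T -> Prop) :
  compact [set: T] -> compact [set: quot E].
Proof.
move=> Tk; have -> : [set: quot E] = \pi_(quot E) @` [set: T].
  by apply/seteqP; split=> // z _; exists (repr z) => //; exact: reprK.
apply: continuous_compact => //; apply: continuous_subspaceT; exact: pi_continuous.
Qed.

Lemma set_type_compact (X : topologicalType) (A : set X) : compact A -> compact [set: A].
Proof.
move=> Ak; have [[x0 Ax0]|A0] := pselect (A !=set0); last first.
  rewrite (_ : [set: A] = set0); first exact: compact0.
  by apply/seteqP; split=> // u _; case: A0; exists (set_val u); exact: set_valP.
(* The value off [A] is arbitrary: only continuity within [A] is used. *)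
pose g (x : X) : A :=
  if pselect (A x) is left Ax then SigSub (mem_set Ax) else SigSub (mem_set Ax0).
have gE x : A x -> set_val (g x) = x by rewrite /g; case: pselect.
have -> : [set: A] = g @` A.
  apply/seteqP; split=> // u _; exists (set_val u); first exact: set_valP.
  by apply: val_inj; exact: (gE _ (set_valP u)).
apply: continuous_compact => //; apply/subspace_continuousP => x Ax O.
rewrite nbhsE => -[W [[B Bo <-] Bx] WO].
have {}Bx : B x by rewrite -(gE x Ax).
apply: filterS (open_nbhs_nbhs (conj Bo Bx)) => y By Ay; apply: WO.
by rewrite /preimage /= gE.
Qed.

End Compact.

Section RealMomentAngleTheory.
Variables (R : realType) (N d : nat) (P : set 'rV[R]_N) (F : 'I_d -> set 'rV[R]_N).

(** The right-hand side is an equivalence relation containing the generators; conversely [a - a'] is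
    a sum of unit vectors of facets through [x], each an elementary identification. *)
Lemma rma_ptP (x x' : P) (a a' : Z2 d) : rma_pt F x a = rma_pt F x' a' <->
  x = x' /\ forall i, (a - a') 0 i != 0 -> F i (set_val x).
Proof.
split=> [/Defs.quotP|[<- aa']].
  pose r (u w : rma_cover d P) := u.1 = w.1 /\
    forall i, ((u.2 : Z2 d) - w.2) 0 i != 0 -> F i (set_val u.1).
  suff H u w : clos_refl_sym_trans _ (rma_rel F) u w -> r u w by move/H.
  elim=> {u w} [u w [i Fi ->]|u|u w _ [uw Fuw]|u w z _ [uw Fuw] _ [wz Fwz]].
  - split=> //= j; rewrite opprD addrA subrr add0r Z2_oppr.
    by move=> /delta_support ->.
  - by split=> // i; rewrite subrr mxE eqxx.
  - by split=> // i; rewrite -uw -opprB Z2_oppr; exact: Fuw.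
  - split; first by rewrite uw.
    move=> i; rewrite -(subrK (w.2 : Z2 d) (u.2 : Z2 d)) -addrA mxE.
    have [->|/Fuw //] := eqVneq (((u.2 : Z2 d) - w.2) 0 i) 0.
    by rewrite add0r uw; exact: Fwz.
rewrite -[a](subrK a') addrC; move: aa'; move: (a - a') => b Fb.
rewrite [b]row_sum_delta; move: a'.
apply: (big_ind (fun y => forall a', rma_pt F x (a' + y) = rma_pt F x a'))
  => [a'|u w Hu Hw a'|i _ a'].
- by rewrite addr0.
- by rewrite addrA Hw Hu.
- have [->|bi] := Z2_cases (b 0 i); first by rewrite scale0r addr0.
  rewrite bi scale1r; apply/esym/Defs.quotP/rst_step; exists i => //=.
  by apply: Fb; rewrite bi.
Qed.

Lemma rma_reprK (z : real_moment_angle P F) : rma_pt F (repr z).1 (repr z).2 = z.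
Proof. by rewrite -[RHS]reprK /rma_pt; case: (repr z). Qed.

Lemma rma_compact : compact P -> compact [set: real_moment_angle P F].
Proof.
move=> Pk; apply: quot_compact.
rewrite (_ : [set: rma_cover d P] = [set: P] `*` [set: discrete_topology (Z2 d)]).
  apply: compact_setX; first exact: set_type_compact.
  by apply: finite_compact; exact: (@finite_finset (Z2 d)).
by apply/seteqP; split.
Qed.

End RealMomentAngleTheory.

Theorem proposition1p5 (R : realType) (n N d m : nat)
    (P : set 'rV[R]_N) (F : 'I_d -> set 'rV[R]_N)
    (Q M : topologicalType)
    (toQ : {action Z2 n &-> Q}) (toM : {action Z2 m &-> M}) (p : M -> Q) :
  simple_polytope n P ->
  set_bij [set: 'I_d] (facet n P) F ->
  small_cover toQ P ->
  principal_bundle toM p ->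
  connected [set: M] ->
  exists (H Ht : {group Z2 d})
         (phi : {morphism [set: Z2 m]%SET >-> coset_of H})
         (theta : orbit_space (canonical_action P F) Ht -> Q),
    let act := orbit_space_action (canonical_action P F) phi in
    let proj := fun z : orbit_space (canonical_action P F) H =>
                  theta (orbit_proj Ht z) in
    [/\ [/\ H \subset Ht,
            free_action (canonical_action P F) Ht,
            isom [set: Z2 m]%SET (Ht / H)%g phi &
            homeomorphism theta],
        principal_bundle act proj &
        bundle_equivalent toM p act proj].
Proof.
move=> P_simple FP Q_cover pb M_connected.
have [q [L [C [Phi [Phi_q Phi_act Phi_eq Phi_facet [indep Phi_onto C_onto]]]]]] :=
  developing_map P_simple FP Q_cover pb M_connected.
have [Ppoly _ _] := P_simple.
have [[_ Qh _ _] _ _] := Q_cover.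
have Mh := bundle_hausdorff pb Qh.
set Z := real_moment_angle P F.
pose dev (z : Z) := Phi (set_val (repr z).1) (repr z).2.
have devE (x : P) a : dev (rma_pt F x a) = Phi (set_val x) a.
  have [] := (rma_ptP F (repr (rma_pt F x a)).1 x (repr (rma_pt F x a)).2 a).1.
    exact: rma_reprK.
  rewrite /dev => -> Fa; rewrite -[(repr _).2](subrK a) addrC.
  by apply: Phi_facet => //; exact: set_valP.
have dev_cts : continuous dev.
  apply/quotient_continuous => -[x a] O.
  rewrite /= -/(rma_pt F x a) devE => /(cvg_near (Phi_q _ a (set_valP x)).2) H.
  have H' : \forall y \near x, O (Phi (set_val y) a).
    have := cvg_near (@initial_continuous _ _ set_val x) H.
    by apply: filterS => y; apply; exact: set_valP.
  exists ([set y | O (Phi (set_val y) a)], [set a]); first by split.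
  by move=> [y b] [/= Oy ->]; rewrite -/(rma_pt F y a) devE.
have dev_act z h : h *m L = 0 -> dev (canonical_action P F z h) = toM (dev z) (h *m C).
  have [x [a ->]] := rma_ptW z; rewrite [canonical_action _ _ _ _]rma_actE !devE.
  by apply: Phi_act; exact: set_valP.
(* [gHt] preserves the fibres of [dev] followed by [p], and [gH] those of [dev] itself. *)
pose gHt : {set Z2 d} := [set h | h *m L == 0]%SET.
pose gH : {set Z2 d} := [set h in gHt | h *m C == 0]%SET.
have Ht_group : group_set gHt.
  apply/group_setP; split=> [|g h]; first by rewrite inE mul0mx eqxx.
  by rewrite !inE => /eqP gL /eqP hL; rewrite mulmxDl gL hL addr0.
have H_group : group_set gH.
  apply/group_setP; split=> [|g h]; first by rewrite !inE !mul0mx !eqxx.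
  rewrite !inE => /andP[/eqP gL /eqP gC] /andP[/eqP hL /eqP hC].
  by rewrite !mulmxDl gL hL gC hC !addr0 !eqxx.
pose Ht := Group Ht_group; pose H := Group H_group.
have HtP h : h \in Ht -> h *m L = 0 by rewrite inE => /eqP.
have HP h : h \in H -> h *m L = 0 /\ h *m C = 0.
  by rewrite !inE => /andP[/eqP ? /eqP].
have HHt : H \subset Ht by apply/fintype.subsetP => h; rewrite inE => /andP[].
have normH h : h \in 'N(H)%g.
  apply: (fintype.subsetP (sub_abelian_norm (FinRing.zmod_abelian _) (finset.subsetT H))).
  by rewrite inE.
have same_fiber u w : p (dev u) = p (dev w) ->
    exists2 h, h *m L = 0 & w = canonical_action P F u h.
  have [x [a ->]] := rma_ptW u; have [x' [a' ->]] := rma_ptW w.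
  rewrite !devE => e; have xx' : x = x'.
    apply: val_inj; rewrite -[LHS](Phi_q _ a (set_valP x)).1 e.
    exact: (Phi_q _ a' (set_valP x')).1.
  rewrite -xx' in e *; have [h hL hF] := Phi_eq _ _ _ (set_valP x) (esym e).
  exists h => //; rewrite [canonical_action _ _ _ _]rma_actE.
  by apply/rma_ptP; split=> // i; rewrite opprD [- h - a]addrC addrA; exact: hF.
pose theta (z : orbit_space (canonical_action P F) Ht) := p (dev (repr z)).
pose devH (z : orbit_space (canonical_action P F) H) := dev (repr z).
have thetaE u : theta (\pi_(orbit_space (canonical_action P F) Ht) u) = p (dev u).
  have /orbit_spaceP [h /HtP hL uE] := reprK (\pi_(orbit_space (canonical_action P F) Ht) u).
  by rewrite {2}uE dev_act // (bundle_proj pb).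
have devHE u : devH (\pi_(orbit_space (canonical_action P F) H) u) = dev u.
  have /orbit_spaceP [h /HP [hL hC] uE] := reprK (\pi_(orbit_space (canonical_action P F) H) u).
  by rewrite {2}uE dev_act // hC act_zero.
have Zk : compact [set: Z] by apply: rma_compact; exact: polytope_compact.
have dev_onto x : exists u, dev u = x.
  have [y [a [Py <-]]] := Phi_onto x.
  by exists (rma_pt F (SigSub (mem_set Py)) a); rewrite devE.
have theta_homeo : homeomorphism theta.
  apply: compact_bij_homeomorphism => //; first exact: quot_compact.
  - apply/quotient_continuous; rewrite (_ : theta \o _ = p \o dev).
      move=> u; apply: continuous_comp; first exact: dev_cts.
      by have [_ pc _] := pb; exact: pc.
    by apply/funext => u; exact: thetaE.
  - move=> z w; rewrite -[z]reprK -[w]reprK !thetaE => /same_fiber [h hL hE].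
    by apply/orbit_spaceP; exists h => //; rewrite inE hL.
  - move=> z; have [U [s [_ Uz sU]]] := bundle_section pb z.
    have [u uE] := dev_onto (s z); exists (\pi_(orbit_space (canonical_action P F) Ht) u).
    by rewrite thetaE uE (sU z Uz).1.
have devH_homeo : homeomorphism devH.
  apply: compact_bij_homeomorphism => //; first exact: quot_compact.
  - apply/quotient_continuous; rewrite (_ : devH \o _ = dev) //.
    by apply/funext => u; exact: devHE.
  - move=> z w; rewrite -[z]reprK -[w]reprK !devHE => zw.
    have [h hL hE] := same_fiber _ _ (congr1 p zw).
    apply/orbit_spaceP; exists h => //; rewrite !inE hL eqxx /=; apply/eqP.
    by apply: (bundle_free pb (x := dev (repr z))); rewrite -dev_act // -hE -zw.
  - move=> x; have [u uE] := dev_onto x.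
    by exists (\pi_(orbit_space (canonical_action P F) H) u); rewrite devHE.
(* An arbitrary set-theoretic inverse of [C] on [Ht]. By [coset_eq] its cosets modulo [H] depend
   only on [t], which makes [phi] a morphism. *)
have /choice [lift liftP] : forall t : Z2 m, exists h : Z2 d, h *m L = 0 /\ h *m C = t.
  by move=> t; have [h hL hC] := C_onto t; exists h.
have coset_eq (h h' : Z2 d) : h *m L = 0 -> h' *m L = 0 ->
    (coset H h = coset H h' <-> h *m C = h' *m C).
  move=> hL hL'; split=> [/rcoset_kercosetP|hC].
    move=> /(_ (normH h) (normH h')) /rcosetP [k /HP [_ kC] ->].
    by rewrite mulmxDl kC add0r.
  apply/rcoset_kercosetP; [exact: normH|exact: normH|].
  apply/rcosetP; exists (h - h'); last by symmetry; exact: subrK.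
  by rewrite !inE !mulmxBl hL hL' hC !subrr !eqxx.
have phiM : {in [set: Z2 m]%SET &, {morph (fun t => coset H (lift t)) : a b / (a * b)%g}}.
  move=> a b _ _; rewrite -morphM ?normH //.
  have [aL aC] := liftP a; have [bL bC] := liftP b; have [abL abC] := liftP (a * b)%g.
  by apply/coset_eq; rewrite // mulmxDl ?aL ?bL ?addr0 // aC bC abC.
pose phi := Morphism phiM.
exists H, Ht, phi, theta => act proj.
have actE u t : act (\pi_(orbit_space (canonical_action P F) H) u) t =
    \pi_(orbit_space (canonical_action P F) H) (canonical_action P F u (lift t)).
  exact: orbit_space_actE.
have devH_act z t : devH (act z t) = toM (devH z) t.
  by rewrite -[z]reprK actE !devHE (dev_act _ _ (liftP t).1) (liftP t).2.
have projE z : proj z = p (devH z).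
  by rewrite -[z]reprK /proj orbit_projE // thetaE devHE.
have [k [dk kd dc kc]] := devH_homeo.
have k_act x t : k (toM x t) = act (k x) t.
  by rewrite -[x in LHS]kd -devH_act dk.
have k_proj x : proj (k x) = p x by rewrite projE kd.
have k_homeo : homeomorphism k by exists devH.
split; last first.
(* The inverse of [devH] commutes with the actions as they stand, so the automorphism is trivial. *)
- by exists k, 1%g; split=> // x t; rewrite perm1.
- exact: principal_bundle_transport k_homeo k_act k_proj pb.
split=> //.
(* If [h] fixes the class of a point over [x], it is supported on facets through [x]; being killed
   by [L], it vanishes by independence. *)
- move=> z h /HtP hL; have [x [a ->]] := rma_ptW z.
  rewrite [canonical_action _ _ _ _]rma_actE => /rma_ptP [_ hF].
  by apply: (indep (set_val x)) hL; [exact: set_valP|move=> i hi; apply: hF; rewrite addrK].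
apply/isomP; split.
  apply/injmP => a b _ _ /coset_eq.
  by rewrite (liftP a).2 (liftP b).2; apply; [exact: (liftP a).1|exact: (liftP b).1].
apply/setP => c; apply/morphimP/morphimP => -[x].
  move=> _ _ ->; exists (lift x) => //.
  by rewrite inE (liftP x).1.
move=> _ /HtP xL ->; exists (x *m C); rewrite ?inE //.
by apply/coset_eq; rewrite // ?(liftP _).1 ?(liftP _).2.
Qed.
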